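(* Let $X,Y$ be Polish spaces, $\mu\in\mathcal{P}(X)$, $\nu\in\mathcal{P}(Y)$, and $\mathbb{P}\in\mathcal{P}(X\times Y)$ with $\mathbb{P}\sim\mu\otimes\nu$. Let $h:[0,\infty)\to(-\infty,\infty)$ be continuous, strictly increasing, continuously differentiable, and twice differentiable on $(0,\infty)$, with $\lim_{x\to 0}h'(x)=0$, $\lim_{x\to+\infty}h'(x)=+\infty$ and $\inf_{(0,\infty)}h''>-\infty$. Assume that the problem $$\inf\left\{\int_{X\times Y}h\Big(\frac{d\mathbb{Q}}{d\mathbb{P}}(x,y)\Big)\,\mathbb{P}(dx,dy):\ \mathbb{Q}\in\mathrm{cpl}(\mu,\nu)\right\}$$ has finite value and that $\mathbb{Q}^*$ is an optimizer thereof. Then there exist measurable functions $\phi:X\to[-\infty,+\infty)$ and $\psi:Y\to[-\infty,+\infty)$ such that $$h'\circ\frac{d\mathbb{Q}^*}{d\mathbb{P}}(x,y)=(\phi(x)+\psi(y))_+\qquad\mathbb{P}\text{-a.s.}$$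
   Context: $\mathcal{P}(\cdot)$ denotes the set of Borel probability measures. $\mathrm{cpl}(\mu,\nu)$ is the set of Borel probability measures on $X\times Y$ with $X$-marginal $\mu$ and $Y$-marginal $\nu$. The objective functional is understood to be $+\infty$ when $\mathbb{Q}\not\ll\mathbb{P}$. $\rho\sim\eta$ means $\rho\ll\eta$ and $\eta\ll\rho$. $a_+:=\max(a,0)$, with $(-\infty)_+=0$. The value $h'(0)$ is $\lim_{x\searrow 0}h'(x)=0$. *)

(* Defs.v *)
(* Setting: MathComp-Analysis over an arbitrary realType. *)
From HB Require Import structures.
From mathcomp Require Import all_boot all_order all_algebra.
From mathcomp Require Import all_classical all_reals all_analysis.
From mathcomp Require Import measurable_realfun.

Set Implicit Arguments.
Unset Strict Implicit.
Unset Printing Implicit Defensive.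

Import Order.TTheory GRing.Theory Num.Theory.
Import numFieldNormedType.Exports.

Local Open Scope classical_set_scope.
Local Open Scope ring_scope.

(* d is a complete metric inducing the topology of T. Nonnegativity follows from
   the axioms. *)
Record complete_metric_for (R : realType) (T : topologicalType)
    (d : T -> T -> R) : Prop := CompleteMetricFor {
  cm_eq0 : forall x y, d x y = 0 <-> x = y ;
  cm_sym : forall x y, d x y = d y x ;
  cm_triangle : forall x y z, d x z <= d x y + d y z ;
  cm_nbhs : forall x (A : set T),
    nbhs x A <-> exists2 e : R, 0 < e & [set y | d x y < e] `<=` A ;
  cm_complete : forall u : nat -> T,
    (forall e : R, 0 < e -> exists N : nat, forall m n : nat,
       (N <= m)%N -> (N <= n)%N -> d (u m) (u n) < e) ->
    exists l : T, u @ \oo --> l }.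

Definition polish (R : realType) (T : topologicalType) : Prop :=
  (exists2 D : set T, countable D & dense D) /\
  exists d : T -> T -> R, complete_metric_for d.

(* Library measurable types are pointed, hence the ptopologicalType below: a
   space carrying a probability measure is nonempty, so nothing is lost.
   The library's product of the measurable types borel X and borel Y is used
   as the Borel space of X * Y; see measurable_borel_prod. *)
Notation borel T := (g_sigma_algebraType (@open T)).

Lemma polish_second_countable (R : realType) (T : topologicalType) :
  polish R T -> @second_countable T.
Proof.
move=> [[D cD dD] [d [d0 ds dt dn _]]].
have ball_open x (e : R) : open [set y | d x y < e].
  rewrite openE => y /= xye; apply/dn.
  exists (e - d x y); first by rewrite subr_gt0.
  move=> z /= yz; apply: le_lt_trans (dt x y z) _.
  by rewrite addrC -ltrBrDr.
pose b (p : T * nat) := [set y | d p.1 y < p.2.+1%:R^-1].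
exists (b @` (D `*` [set: nat])).
  by apply: sub_countable (card_image_le _ _) _; exact: countableX.
split=> [_ [p _ <-]|x A /dn[e e0 eA]]; first exact: ball_open.
have [n] : exists n, n.+1%:R^-1 < e / 2.
  have e20 : 0 < e / 2 by rewrite divr_gt0.
  by have [n _ /(_ n (leqnn n))] := near_infty_natSinv_lt (PosNum e20); exists n.
move=> ne; have n0 : (0 : R) < n.+1%:R^-1 by rewrite invr_gt0.
have [|z [/= xz Dz]] := dD [set y | d x y < n.+1%:R^-1] _ (ball_open _ _).
  by exists x => /=; rewrite (d0 x x).2.
exists (b (z, n)); first by split; [exists (z, n)|rewrite /b/= ds].
move=> y /= zy; apply: eA => /=; apply: le_lt_trans (dt x z y) _.
by rewrite (splitr e) ltrD // (lt_trans _ ne).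
Qed.

Lemma measurable_borel_prod (R : realType) (X Y : ptopologicalType) :
  polish R X -> polish R Y ->
  (measurable : set (set (borel X * borel Y)%type)) =
  <<s (@open (X * Y)%type) >>.
Proof.
move=> /polish_second_countable[B1 cB1 [oB1 bB1]].
move=> /polish_second_countable[B2 cB2 [oB2 bB2]].
rewrite measurable_prod_measurableType eqEsubset; split.
  apply: smallest_sub; first exact: smallest_sigma_algebra.
  have fstP : measurable_fun [set: borel (X * Y)%type]
      (fst : borel (X * Y)%type -> borel X).
    apply: (measurability (rT := borel X) (@open X) erefl) => _ [U oU <-].
    rewrite setTI; apply: sub_sigma_algebra.
    by apply: open_comp => // ? _; exact: cvg_fst.
  have sndP : measurable_fun [set: borel (X * Y)%type]
      (snd : borel (X * Y)%type -> borel Y).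
    apply: (measurability (rT := borel Y) (@open Y) erefl) => _ [U oU <-].
    rewrite setTI; apply: sub_sigma_algebra.
    by apply: open_comp => // ? _; exact: cvg_snd.
  move=> _ [U mU [V mV <-]].
  have := measurableI _ _ (fstP measurableT _ mU) (sndP measurableT _ mV).
  by rewrite !setTI.
rewrite -measurable_prod_measurableType.
apply: smallest_sub.
  split=> [|A mA|F mF]; first exact: measurable0.
    by rewrite setTD; exact: measurableC.
  exact: bigcup_measurable.
move=> U oU.
pose C := [set p : set X * set Y |
  [/\ B1 p.1, B2 p.2 & p.1 `*` p.2 `<=` U]].
have -> : U = \bigcup_(p in C) (p.1 `*` p.2).
  apply/seteqP; split=> [[x y] Uxy|z [p [_ _ pU] pz]]; last exact: pU.
  have : nbhs (x, y) U by exact: open_nbhs_nbhs.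
  move=> [[V W] /= [/bB1[V' [BV' V'x] V'V] /bB2[W' [BW' W'y] W'W]] VWU].
  exists (V', W') => //; split=> //= -[a b] [/= /V'V Va /W'W Wb].
  exact: VWU.
have cC : countable C.
  apply: sub_countable (countableX cB1 cB2).
  by apply: subset_card_le => p [].
have /pfcard_geP[->|[f]] := cC; first by rewrite bigcup_set0.
have -> : \bigcup_(p in C) (p.1 `*` p.2) =
    \bigcup_(n : nat) ((f n).1 `*` (f n).2).
  apply/seteqP; split=> [z [p Cp pz]|z [n _ nz]].
    by have [n _ fn] := 'surj_f Cp; exists n => //; rewrite fn.
  by exists (f n) => //; exact: funS.
apply: bigcup_measurable => n _; have [b1 b2 _] : C (f n) by exact: funS.
by apply: measurableX; apply: sub_sigma_algebra; [exact: oB1|exact: oB2].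
Qed.

Section transport.
Local Open Scope ereal_scope.
Context {R : realType} {X Y : ptopologicalType}.
Implicit Types (mu : probability (borel X) R) (nu : probability (borel Y) R).
Implicit Types P Q : probability (borel X * borel Y)%type R.

Definition cpl mu nu : set (probability (borel X * borel Y)%type R) :=
  [set Q | (forall A : set (borel X), measurable A ->
              pushforward Q fst A = mu A) /\
           (forall B : set (borel Y), measurable B ->
              pushforward Q snd B = nu B)].

(* Radon_Nikodym_SigmaFinite.f is the everywhere finite and nonnegative version
   of dQ/dP when Q `<< P; otherwise it is -oo and the density below is 0. *)
Definition density Q P (z : X * Y) : R :=
  fine (Radon_Nikodym_SigmaFinite.f Q P z).

(* For h bounded below on [0, +oo[ the integral is well defined in ]-oo, +oo]. *)
Definition objective (h : R -> R) P Q : \bar R :=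
  if `[< Q `<< P >] then \int[P]_z (h (density Q P z))%:E else +oo.

Definition transport_value (h : R -> R) P mu nu : \bar R :=
  ereal_inf [set objective h P Q | Q in cpl mu nu].

End transport.

(* h' on [0, +oo[, with h'(0) the limit of h' at 0 from the right. A function on
   [0, +oo[ is encoded as a total h : R -> R whose values on ]-oo, 0[ are never
   constrained nor used. *)
Definition deriv_ext (R : realType) (h : R -> R) (x : R) : R :=
  if 0 < x then derive1 h x else lim (derive1 h y @[y --> 0^'+]).

(* adm_deriv_continuous is continuous differentiability on [0, +oo[: together
   with adm_continuous it makes deriv_ext h 0 the one-sided derivative at 0. *)
Record admissible (R : realType) (h : R -> R) : Prop := Admissible {
  adm_continuous : {within `[0, +oo[, continuous h} ;
  adm_increasing : {in `[0, +oo[ &, {homo h : x y / x < y}} ;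
  adm_derivable : forall x : R, 0 < x -> derivable h x 1 ;
  adm_deriv_continuous : {within `[0, +oo[, continuous (deriv_ext h)} ;
  adm_derivable2 : forall x : R, 0 < x -> derivable (derive1 h) x 1 ;
  adm_deriv_at0 : derive1 h x @[x --> 0^'+] --> (0 : R) ;
  adm_deriv_atoo : derive1 h x @[x --> +oo] --> +oo ;
  adm_deriv2_lb :
    (-oo < ereal_inf [set (derive1n 2 h x)%:E | x in [set x : R | (0 < x)%R]])%E }.

(* Main.v *)
Require Import Defs.
From HB Require Import structures.
From mathcomp Require Import all_boot all_order all_algebra.
From mathcomp Require Import ring lra.
From mathcomp Require Import all_classical all_reals all_analysis.
From mathcomp Require Import measurable_realfun.

Set Implicit Arguments.
Unset Strict Implicit.
Unset Printing Implicit Defensive.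

Import Order.TTheory GRing.Theory Num.Theory.
Import numFieldNormedType.Exports.

(* Write [f = dQ*/dP], [c = h' o f] and [G = {f > 0}]. Since [c = 0] off [G], it
   is enough to find [phi], [psi] with [phi + psi = c] on [G] and
   [phi + psi <= c] off [G], almost everywhere. Let [misfit] measure the failure
   of these constraints and minimise the energy [E_P[w * loss (misfit)]] over all
   measurable [phi], [psi], where [loss s = sqrt (1 + s ^ 2) - 1] and [w > 0] is a
   small weight.
   - A minimiser exists: strict convexity of [loss] makes the misfits of a
     minimising sequence converge almost everywhere, and taking [limsup phi_n]
     and [liminf psi_n] then loses nothing. This uses [P ~ mu (x) nu].
   - As [loss] has slope at most 1, the derivative [g = w * loss' (misfit)] is
     bounded by [w]. Stationarity of the energy says that [g] has null marginals
     and that [E_P[g * (phi + psi)] <= 0], and [g >= 0] off [G]. Hence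
     [E_P[g * c] <= - E_P[g * misfit]].
   - For [w] small enough, [(f + t g) P] is a coupling for [0 <= t <= 1], and
     optimality of [Q*] gives [E_P[g * c] >= 0].
   So [E_P[g * misfit] <= 0] with [g * misfit >= 0], vanishing only where the
   misfit does. Convexity of [h] is never needed. *)

Local Open Scope classical_set_scope.
Local Open Scope ring_scope.

(** * The loss function *)

Section loss.
Context {R : realType}.
Implicit Types s t : R.

Definition hypot1 s := Num.sqrt (1 + s ^+ 2).

Definition loss s := hypot1 s - 1.

Definition dloss s := s / hypot1 s.

Lemma sqr_hypot1 s : hypot1 s ^+ 2 = 1 + s ^+ 2.
Proof. by rewrite sqr_sqrtr// addr_ge0// sqr_ge0. Qed.

Lemma hypot1_ge1 s : 1 <= hypot1 s.
Proof. by rewrite -{1}sqrtr1 ler_wsqrtr// lerDl sqr_ge0. Qed.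

Lemma hypot1_gt0 s : 0 < hypot1 s.
Proof. exact: lt_le_trans ltr01 (hypot1_ge1 s). Qed.

Lemma hypot1_neq0 s : hypot1 s != 0.
Proof. by rewrite gt_eqF// hypot1_gt0. Qed.

Lemma hypot1_le s u : 0 <= u -> 1 + s ^+ 2 <= u ^+ 2 -> hypot1 s <= u.
Proof.
move=> u0 su; rewrite -(@ler_pXn2r _ 2)// ?nnegrE ?sqrtr_ge0//.
by rewrite sqr_hypot1.
Qed.

Lemma le_hypot1_norm s t : `|s| <= `|t| -> hypot1 s <= hypot1 t.
Proof.
move=> st; apply: hypot1_le; first exact: sqrtr_ge0.
by rewrite sqr_hypot1 lerD2l -(real_normK (num_real s))
  -(real_normK (num_real t)) ler_pXn2r.
Qed.

Lemma loss_ge0 s : 0 <= loss s.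
Proof. by rewrite subr_ge0 hypot1_ge1. Qed.

Lemma loss0 : loss 0 = 0.
Proof. by rewrite /loss /hypot1 expr0n addr0 sqrtr1 subrr. Qed.

Lemma le_loss_norm s t : `|s| <= `|t| -> loss s <= loss t.
Proof. by move=> st; rewrite lerB// le_hypot1_norm. Qed.

Lemma loss_le_norm s : loss s <= `|s|.
Proof.
rewrite lerBlDr; apply: hypot1_le; first by rewrite addr_ge0.
have := normr_ge0 s; have := real_normK (num_real s); nra.
Qed.

Lemma norm_le_loss s : `|s| <= loss s + 1.
Proof.
rewrite subrK -sqrtr_sqr ler_wsqrtr//; lra.
Qed.

Lemma dloss0 : dloss 0 = 0.
Proof. by rewrite /dloss mul0r. Qed.

Lemma dloss_ge0 s : 0 <= s -> 0 <= dloss s.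
Proof. by move=> s0; rewrite divr_ge0// sqrtr_ge0. Qed.

Lemma norm_dloss_le1 s : `|dloss s| <= 1.
Proof.
rewrite normrM normfV (gtr0_norm (hypot1_gt0 s)) ler_pdivrMr ?hypot1_gt0//.
by rewrite mul1r -sqrtr_sqr ler_wsqrtr// lerDr.
Qed.

Lemma dloss_mul_gt0 s : s != 0 -> 0 < dloss s * s.
Proof.
move=> s0; rewrite /dloss mulrAC -expr2 divr_gt0 ?hypot1_gt0//.
by rewrite exprn_even_gt0.
Qed.

(** Second-order Taylor bound, [loss] having second derivative at most 1. After adding 1 to both
    sides it becomes a bound on [hypot1 (s + t)], proved by squaring. *)
Lemma loss_upper s t : loss (s + t) <= loss s + dloss s * t + t ^+ 2 / 2.
Proof.
have A1 := hypot1_ge1 s; have AE := sqr_hypot1 s.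
have -> : loss s + dloss s * t + t ^+ 2 / 2 =
    hypot1 s + (dloss s * t + t ^+ 2 / 2) - 1 by rewrite /loss; ring.
rewrite lerB//; set A := hypot1 s in A1 AE *.
have -> : dloss s = s / A by [].
have A0 : A != 0 := hypot1_neq0 s.
set r := s / A; have sE : s = r * A by rewrite /r divfK.
have r1 : r ^+ 2 <= 1.
  by rewrite -(real_normK (num_real r)) expr_le1// norm_dloss_le1.
apply: hypot1_le; first by nra.
rewrite sE; rewrite sE in AE.
(* With [s = r * A], the square of the upper bound exceeds [1 + (s + t) ^ 2] by exactly the sum of
   these two nonnegative terms. *)
have : 0 <= (A - 1) * t ^+ 2 by rewrite mulr_ge0 ?subr_ge0 ?sqr_ge0.
have : 0 <= (r * t + t ^+ 2 / 2) ^+ 2 by rewrite sqr_ge0.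
nra.
Qed.

(* The triangle inequality for the vectors [(1, s)] and [(1, t)], whose defect
   controls the distance between their directions. *)
Lemma loss_midpoint s t :
  2 * loss ((s + t) / 2) + (dloss s - dloss t) ^+ 2 / 4 <= loss s + loss t.
Proof.
have [A1 B1] := (hypot1_ge1 s, hypot1_ge1 t).
have [AE BE] := (sqr_hypot1 s, sqr_hypot1 t).
have [A0 B0] := (hypot1_neq0 s, hypot1_neq0 t).
have [r1 q1] := (norm_dloss_le1 s, norm_dloss_le1 t).
pose D := (dloss s - dloss t) ^+ 2.
have D0 : 0 <= D by rewrite sqr_ge0.
have D4 : D <= 4.
  rewrite /D -(real_normK (num_real _)).
  have := ler_normB (dloss s) (dloss t); have := normr_ge0 (dloss s - dloss t).
  by move: (`|_ - _|) r1 q1 => x; nra.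
rewrite /loss -/D.
suff : hypot1 ((s + t) / 2) <= (hypot1 s + hypot1 t - D / 4) / 2 by lra.
apply: hypot1_le; first by lra.
(* [D] is the squared difference of the second coordinates of the unit vectors along [(1, s)] and
   [(1, t)]. It is at most their squared distance, [2 - 2 (1 + s t) / (hypot1 s * hypot1 t)]. *)
have DAB : 1 + s * t + hypot1 s * hypot1 t * D / 2 <= hypot1 s * hypot1 t.
  have -> : hypot1 s * hypot1 t * D = (hypot1 t / hypot1 s) * s ^+ 2 - 2 * s * t
      + (hypot1 s / hypot1 t) * t ^+ 2.
    by rewrite /D /dloss; field; rewrite A0 B0.
  have -> : s ^+ 2 = hypot1 s ^+ 2 - 1 by rewrite AE; ring.
  have -> : t ^+ 2 = hypot1 t ^+ 2 - 1 by rewrite BE; ring.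
  have -> : hypot1 t / hypot1 s * (hypot1 s ^+ 2 - 1) =
      hypot1 s * hypot1 t - hypot1 t / hypot1 s by field.
  have -> : hypot1 s / hypot1 t * (hypot1 t ^+ 2 - 1) =
      hypot1 s * hypot1 t - hypot1 s / hypot1 t by field.
  have : 2 <= hypot1 t / hypot1 s + hypot1 s / hypot1 t.
    rewrite -subr_ge0; have -> : hypot1 t / hypot1 s + hypot1 s / hypot1 t - 2 =
      (hypot1 s - hypot1 t) ^+ 2 / (hypot1 s * hypot1 t).
      by field; rewrite A0 B0.
    by rewrite divr_ge0 ?sqr_ge0// mulr_ge0 ?sqrtr_ge0.
  lra.
move: (hypot1 s) (hypot1 t) A1 B1 AE BE DAB => A B A1 B1 AE BE DAB.
(* After squaring and inserting [DAB], what is left is [D * (A + B) / 2 <= D * A * B], which holds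
   as [A] and [B] are at least 1. *)
have : 0 <= D * (2 * (A * B) - (A + B)).
  by rewrite mulr_ge0//; nra.
nra.
Qed.

Lemma hypot1_dloss s : hypot1 s = (Num.sqrt (1 - dloss s ^+ 2))^-1.
Proof.
have A0 := hypot1_neq0 s.
have -> : 1 - dloss s ^+ 2 = (hypot1 s)^-1 ^+ 2.
  rewrite /dloss exprMn exprVn sqr_hypot1; field.
  by rewrite -sqr_hypot1 expf_neq0.
by rewrite sqrtr_sqr ger0_norm ?invr_ge0 ?sqrtr_ge0// invrK.
Qed.

(** Inverse of [dloss] on []-1, 1[]: it turns convergence of [dloss (a n)] to a limit inside this
    interval into convergence of [a n]. *)
Lemma dloss_inv s : s = dloss s / Num.sqrt (1 - dloss s ^+ 2).
Proof. by rewrite -hypot1_dloss /dloss divfK// hypot1_neq0. Qed.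

End loss.

(** * Residuals of equality and one-sided constraints *)

Section residual.
Context {R : realType}.
Implicit Types (b : bool) (s t : R).

(* The violation by [s] of the constraint [s = 0] if [b], [s <= 0] otherwise. *)
Definition residual b s := if b then s else Num.max s 0.

Lemma norm_residual_le b s : `|residual b s| <= `|s|.
Proof.
case: b => //=; rewrite ger0_norm ?le_max ?lexx ?orbT//.
by rewrite ge_max ler_norm normr_ge0.
Qed.

Lemma residual_le b s : s <= residual b s.
Proof. by case: b => //=; rewrite le_max lexx. Qed.

(** As [loss] has slope 0 at 0, composing it with the positive part creates no kink, and the
    quadratic bound of [loss_upper] survives. *)
Lemma loss_residual_upper b s t :
  loss (residual b (s + t)) <=
  loss (residual b s) + dloss (residual b s) * t + t ^+ 2 / 2.
Proof.
case: b => /=; first exact: loss_upper.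
have [s0|s0] := leP 0 s.
  apply: le_trans (loss_upper s t).
  exact/le_loss_norm/(norm_residual_le false).
rewrite loss0 dloss0 mul0r !add0r.
apply: (@le_trans _ _ (loss t)); last first.
  by have := loss_upper 0 t; rewrite loss0 dloss0 mul0r !add0r.
apply: le_loss_norm; rewrite ger0_norm ?le_max ?lexx ?orbT// ge_max normr_ge0.
by rewrite andbT (le_trans _ (ler_norm t))// gerDr ltW.
Qed.

(** Both residuals are convex, and on the one-sided branch they take values in the half-line where
    [loss] increases, so [loss_midpoint] carries over. *)
Lemma loss_residual_midpoint b s t :
  2 * loss (residual b ((s + t) / 2)) +
    (dloss (residual b s) - dloss (residual b t)) ^+ 2 / 4 <=
  loss (residual b s) + loss (residual b t).
Proof.
apply: le_trans (loss_midpoint _ _); rewrite lerD2r ler_pM2l//.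
case: b => //=; have s0 : s <= Num.max s 0 by rewrite le_max lexx.
have t0 : t <= Num.max t 0 by rewrite le_max lexx.
have s00 : 0 <= Num.max s 0 by rewrite le_max lexx orbT.
have t00 : 0 <= Num.max t 0 by rewrite le_max lexx orbT.
apply: le_loss_norm; rewrite !ger0_norm ?le_max ?lexx ?orbT//; last by lra.
by rewrite ge_max; lra.
Qed.

(* Only the points where the residual is [u - c] contribute to the first-order
   condition, which lets [c >= 0] replace the integrability of [u]. *)
Lemma dloss_residual_mul b u c : 0 <= c ->
  dloss (residual b (u - c)) * u =
  dloss (residual b (u - c)) * (residual b (u - c) + c).
Proof.
move=> c0; case: b => /=; first by rewrite subrK.
have [uc|uc] := leP 0 (u - c); first by rewrite subrK.
by rewrite dloss0 !mul0r.
Qed.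

Lemma dist_loss s t : `|loss s - loss t| <= `|s - t|.
Proof.
wlog st : s t / loss t <= loss s.
  move=> H; case/orP: (le_total (loss t) (loss s)) => ?; first exact: H.
  by rewrite distrC [leRHS]distrC; exact: H.
rewrite ger0_norm ?subr_ge0// /loss opprB addrA subrK lerBlDr.
apply: hypot1_le; first by rewrite addr_ge0// sqrtr_ge0.
rewrite sqrrD sqr_hypot1 real_normK ?num_real//.
have : `|t| <= hypot1 t.
  rewrite -[leLHS]ger0_norm// -sqrtr_sqr ler_wsqrtr//.
  by rewrite real_normK ?num_real// lerDr.
have := normr_ge0 (s - t); have := ler_norm ((s - t) * t); rewrite normrM.
nra.
Qed.

(** Scaling moves [u] by [r * u]. Under an equality constraint, or when [u > c], [u] is the residual
    plus [c]. In the one-sided case with [u <= c] both residuals vanish, so a very negative [u]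
    costs nothing. *)
Lemma loss_residual_shrink b u c (r : R) : 0 <= c -> 0 <= r <= 1 ->
  loss (residual b ((1 - r) * u - c)) - loss (residual b (u - c)) <=
  r * (`|residual b (u - c)| + c).
Proof.
move=> c0 /andP[r0 r1].
apply: le_trans (ler_norm _) _; apply: le_trans (dist_loss _ _) _.
case: b => /=.
  have -> : (1 - r) * u - c - (u - c) = - (r * u) by ring.
  rewrite normrN normrM ger0_norm// ler_wpM2l//.
  by rewrite -[in leLHS](subrK c u) (le_trans (ler_normD _ _))// (ger0_norm c0).
have rc : 0 <= r * c by rewrite mulr_ge0.
have [u0|u0] := leP u c.
  have -> : Num.max (u - c) 0 = 0 by apply/max_idPr; lra.
  have -> : Num.max ((1 - r) * u - c) 0 = 0.
    apply/max_idPr; case: (leP 0 u) => u1.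
      have : 0 <= r * u by rewrite mulr_ge0.
      lra.
    have : (1 - r) * u <= 0 by rewrite mulr_ge0_le0 ?subr_ge0// ltW.
    lra.
  by rewrite subrr normr0 add0r.
have u00 : 0 <= u by lra.
have ru : 0 <= r * u by rewrite mulr_ge0.
have -> : Num.max (u - c) 0 = u - c by apply/max_idPl; lra.
rewrite [in leRHS]ger0_norm; last by lra.
rewrite subrK ler_norml; apply/andP; split.
  have : (1 - r) * u - c <= Num.max ((1 - r) * u - c) 0 by rewrite le_max lexx.
  lra.
rewrite lerBlDr ge_max; apply/andP; split; lra.
Qed.

End residual.

(** * Almost everywhere convergence from small energy gaps *)

Section loss_convergence.
Context {R : realType}.

(** Let [b] be the limit of [dloss (a n)]. If [1 - b ^ 2] has a nonzero square root, [dloss_inv]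
    gives the limit of [a n]. Otherwise [hypot1 (a n)] tends to infinity, which the finite lower
    limit of the losses excludes. *)
Lemma is_cvg_dloss_inv (a : R^nat) (k : R) : 0 < k ->
  (limn_einf (fun n => (k * loss (a n))%:E) < +oo)%E ->
  cvgn (dloss \o a) -> cvgn a.
Proof.
move=> k0 aoo /cvg_ex[/= b ab].
have cD : (fun n => Num.sqrt (1 - dloss (a n) ^+ 2)) @ \oo -->
    Num.sqrt (1 - b ^+ 2).
  apply: continuous_cvg; first exact: sqrt_continuous.
  apply: cvgB; first exact: cvg_cst.
  by rewrite expr2; under eq_fun do rewrite expr2; apply: cvgM.
have [b1|b1] := eqVneq (Num.sqrt (1 - b ^+ 2)) 0; last first.
  apply/cvg_ex; exists (b / Num.sqrt (1 - b ^+ 2)).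
  have -> : a = fun n => dloss (a n) / Num.sqrt (1 - dloss (a n) ^+ 2).
    by apply/funext => n; exact: dloss_inv.
  by apply: cvgM => //; exact: cvgV.
suff : (fun n => (k * loss (a n))%:E) @ \oo --> +oo%E.
  by move=> /cvg_limn_einf_sup[E _]; rewrite E ltxx in aoo.
apply/cvgeryP.
have hy : (fun n => hypot1 (a n)) @ \oo --> +oo.
  have hV : (fun n => (hypot1 (a n))^-1) @ \oo --> 0.
    by rewrite -b1; under eq_fun do rewrite hypot1_dloss invrK.
  by apply/gtr0_cvgV0 => //; apply: nearW => n; exact: hypot1_gt0.
apply/cvgryPge => A; move/cvgryPge : hy => /(_ (A / k + 1)).
apply: filterS => n; rewrite -lerBrDr -/(loss _) ler_pdivrMr//.
by rewrite mulrC.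
Qed.



Lemma loss_continuous : continuous (@loss R).
Proof.
move=> s; apply: cvgB; last exact: cvg_cst.
apply: continuous_cvg; first exact: sqrt_continuous.
apply: cvgD; first exact: cvg_cst.
exact: exprn_continuous.
Qed.

Lemma measurable_loss : measurable_fun [set: R] (@loss R).
Proof. by apply: continuous_measurable_fun; exact: loss_continuous. Qed.

Lemma measurable_dloss : measurable_fun [set: R] (@dloss R).
Proof.
apply: measurable_funM => //; apply: continuous_measurable_fun => s.
apply: cvgV; [exact: hypot1_neq0|rewrite /hypot1].
apply: continuous_cvg; first exact: sqrt_continuous.
apply: cvgD; first exact: cvg_cst.
exact: exprn_continuous.
Qed.

End loss_convergence.

Section limn_einf.
Local Open Scope ereal_scope.
Context {R : realType}.

Lemma limn_einf_ge (u : (\bar R)^nat) m :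
  (forall n, m <= u n) -> m <= limn_einf u.
Proof.
move=> mu; rewrite limn_einf_lim; apply: lime_ge; first exact: is_cvg_einfs.
by apply: nearW => n; apply: le_ereal_inf_tmp => _ [k _ <-].
Qed.

Lemma limn_einf_le (u : (\bar R)^nat) m :
  (forall n, u n <= m) -> limn_einf u <= m.
Proof.
move=> um; rewrite limn_einf_lim; apply: lime_le; first exact: is_cvg_einfs.
apply: nearW => n; apply: le_trans (um n).
by apply: ereal_inf_lbound; exists n => /=.
Qed.

Lemma measurable_fun_limn_einf d (T : measurableType d)
    (f : (T -> \bar R)^nat) :
  (forall n, measurable_fun [set: T] (f n)) ->
  measurable_fun [set: T] (fun x => limn_einf (f ^~ x)).
Proof.
move=> mf; apply: measurableT_comp => //.
by apply: measurable_fun_limn_esup => n; exact: measurableT_comp.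
Qed.

End limn_einf.

Section ae_convergence.
Context {d : measure_display} {T : measurableType d} {R : realType}.
Variable P : probability T R.
Variables (w : T -> R) (a : (T -> R)^nat).
Hypothesis mw : measurable_fun [set: T] w.
Hypothesis w01 : forall z, 0 < w z <= 1.
Hypothesis ma : forall n, measurable_fun [set: T] (a n).

Local Open Scope ereal_scope.

(** The square bounds give summable bounds on the weighted integrals of the absolute increments.
    Hence the series of increments converges absolutely almost everywhere, and it telescopes. *)
Lemma ae_cvg_dloss :
  (forall n, \int[P]_z (w z * (dloss (a n z) - dloss (a n.+1 z)) ^+ 2)%:E <=
             (8 / (2 ^+ n) ^+ 2)%:E) ->
  {ae P, forall z, cvgn (fun n => dloss (a n z))}.
Proof.
move=> small; pose f n z := (w z * `|dloss (a n.+1 z) - dloss (a n z)|)%R.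
have mD n : measurable_fun [set: T] (fun z => dloss (a n z)).
  exact: measurableT_comp measurable_dloss (ma n).
have mf n : measurable_fun [set: T] (f n).
  apply: measurable_funM => //.
  apply: measurableT_comp => //; exact: measurable_funB.
have f0 n z : 0 <= (f n z)%:E.
  by rewrite lee_fin mulr_ge0//; case/andP: (w01 z) => /ltW.
(* The constant is [2^-n + 2^n * 8 / 4^n = 9 / 2^n], written in the form that the geometric series
   with ratio one half expects. *)
have fle n : \int[P]_z (f n z)%:E <= (18 / (2 ^ (n + 1))%:R)%:E.
  pose g z := (w z * (dloss (a n z) - dloss (a n.+1 z)) ^+ 2)%R.
  have mg : measurable_fun [set: T] g.
    by apply: measurable_funM => //; apply: measurable_funX; exact: measurable_funB.
  have g0 z : (0 <= g z)%R.
    by rewrite mulr_ge0 ?sqr_ge0//; case/andP: (w01 z) => /ltW.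
  have v0 : (0 < 2 ^+ n :> R)%R by rewrite exprn_gt0.
  apply: (@le_trans _ _ (\int[P]_z (((2 ^+ n)^-1)%:E + (2 ^+ n)%:E * (g z)%:E))).
    apply: ge0_le_integral => //.
    - exact/measurable_EFinP.
    - apply: emeasurable_funD => //; apply: emeasurable_funM => //.
      exact/measurable_EFinP.
    - (* AM-GM: [x <= 2^-n + 2^n x^2] *)
      move=> z _; rewrite -EFinM -EFinD lee_fin /f /g distrC.
      rewrite -(real_normK (num_real (_ - _))%R).
      move: (`|_|)%R (normr_ge0 (dloss (a n z) - dloss (a n.+1 z)))%R => x x0.
      have /andP[wz0 wz1] := w01 z.
      have wi : (w z * (2 ^+ n)^-1 <= (2 ^+ n)^-1)%R.
        by rewrite ler_piMl// invr_ge0 ltW.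
      apply: (@le_trans _ _ (w z * ((2 ^+ n)^-1 + 2 ^+ n * x ^+ 2)))%R; last first.
        by rewrite mulrDr mulrCA lerD2r.
      apply: ler_wpM2l; first exact: ltW.
      have -> : (x = (2 ^+ n)^-1 * (2 ^+ n * x))%R by rewrite mulKf// gt_eqF.
      have -> : ((2 ^+ n)^-1 + 2 ^+ n * ((2 ^+ n)^-1 * (2 ^+ n * x)) ^+ 2 =
         (2 ^+ n)^-1 * (1 + (2 ^+ n * x) ^+ 2))%R by field; rewrite gt_eqF.
      rewrite ler_wpM2l ?invr_ge0 ?ltW//.
      by move: (2 ^+ n * x)%R => y; nra.
  rewrite ge0_integralD//; last 2 first.
  - by move=> z _; rewrite mule_ge0 ?lee_fin// ltW.
  - by apply: emeasurable_funM => //; exact/measurable_EFinP.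
  rewrite integral_cst// [X in _ * X]probability_setT mule1.
  rewrite ge0_integralZl//; last 2 first.
  - exact/measurable_EFinP.
  - by move=> z _; rewrite lee_fin.
  apply: (@le_trans _ _ (((2 ^+ n)^-1)%:E + (2 ^+ n)%:E * (8 / (2 ^+ n) ^+ 2)%:E)).
    by rewrite leeD2l// lee_pmul2l//; exact: small.
  rewrite -EFinM -EFinD lee_fin addn1 natrX [(2 ^+ n.+1)%R]exprS le_eqVlt.
  apply/orP; left.
  by apply/eqP; move: (2 ^+ n)%R v0 => v v0; field; rewrite gt_eqF.
have sum_fin : \int[P]_z (\sum_(n <oo) (f n z)%:E) < +oo.
  rewrite integral_nneseries//; last by move=> n; exact/measurable_EFinP.
  apply: (@le_lt_trans _ _ (\sum_(n <oo) (18 / (2 ^ (n + 1))%:R)%:E)).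
    by apply: lee_nneseries => // n _ _; exact: integral_ge0.
  by rewrite (cvg_lim _ (@cvg_geometric_eseries_half R 18 0))// ltry.
have := @integrable_ae _ _ _ P _ measurableT (fun z => \sum_(n <oo) (f n z)%:E).
case.
  apply/integrableP; split.
    by apply: ge0_emeasurable_sum => // n _; exact/measurable_EFinP.
  under eq_integral => z _ do rewrite gee0_abs ?nneseries_ge0//.
  exact: sum_fin.
move=> N [mN N0 sub]; exists N; split => // z /= nz; apply: sub => /= zfin.
apply: nz; have {}zfin := zfin I.
have /andP[wz0 _] := w01 z.
rewrite [X in cvgn X](_ : _ = (fun n => dloss (a 0%N z) +
    series (telescope (fun n => dloss (a n z))) n)%R); last first.
  by apply/funext => n; rewrite -eq_sum_telescope.
apply: is_cvgD; first exact: is_cvg_cst.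
apply: normed_cvg.
apply: nondecreasing_is_cvgn.
  by apply: nondecreasing_series => n *; exact: normr_ge0.
exists (fine (\sum_(n <oo) (f n z)%:E) / w z)%R => _ [n _ <-].
rewrite ler_pdivlMr// -lee_fin fineK//.
apply: le_trans (nneseries_lim_ge n _) => //.
by rewrite sumEFin lee_fin /series/= mulr_suml ler_sum// => i _; rewrite /f mulrC.
Qed.

(** By Fatou the lower limit of the weighted losses is integrable, hence finite almost everywhere.
    So the sequence cannot escape to infinity and [is_cvg_dloss_inv] applies. *)
Lemma ae_cvg_of_loss (M : R) :
  (forall n, \int[P]_z (w z * loss (a n z))%:E <= M%:E) ->
  {ae P, forall z, cvgn (fun n => dloss (a n z))} ->
  {ae P, forall z, cvgn (fun n => a n z)}.
Proof.
move=> bnd; pose f z := limn_einf (fun n => (w z * loss (a n z))%:E).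
have mf n : measurable_fun [set: T] (fun z => (w z * loss (a n z))%:E).
  apply/measurable_EFinP; apply: measurable_funM => //.
  exact: measurableT_comp measurable_loss (ma n).
have f0 n z : 0 <= (w z * loss (a n z))%:E.
  by rewrite lee_fin mulr_ge0 ?loss_ge0//; case/andP: (w01 z) => /ltW.
have ff0 z : 0 <= f z by exact: limn_einf_ge.
have : P.-integrable [set: T] f.
  apply/integrableP; split; first exact: measurable_fun_limn_einf.
  under eq_integral => z _ do rewrite gee0_abs//.
  have := @fatou _ _ _ P _ measurableT _ mf (fun n z _ => f0 n z).
  move=> /le_lt_trans; apply.
  by apply: le_lt_trans (limn_einf_le bnd) _; exact: ltry.
move=> /(integrable_ae measurableT); apply: filterS2 => z /(_ I) fz.
apply: (@is_cvg_dloss_inv _ _ (w z)); first by case/andP: (w01 z).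
by rewrite -/(f z) ltey_eq fz.
Qed.

End ae_convergence.

(** * The energy and its minimisers *)

Section energy.
Local Open Scope ereal_scope.
Context {d1 d2 : measure_display} {X : measurableType d1}
  {Y : measurableType d2} {R : realType}.
Variable P : probability (X * Y)%type R.
Variables (G : set (X * Y)) (c w : X * Y -> R).
Hypothesis mG : measurable G.
Hypothesis mc : measurable_fun [set: X * Y] c.
Hypothesis mw : measurable_fun [set: X * Y] w.
Hypothesis c0 : forall z, (0 <= c z)%R.
Hypothesis w01 : forall z, (0 < w z <= 1)%R.
Hypothesis wc1 : forall z, (w z * c z <= 1)%R.
Implicit Types (phi : X -> R) (psi : Y -> R).

Definition misfit phi psi z : R :=
  residual (z \in G) (phi z.1 + psi z.2 - c z).

Definition energy phi psi : \bar R :=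
  \int[P]_z (w z * loss (misfit phi psi z))%:E.

Definition min_energy : \bar R :=
  ereal_inf [set energy p.1 p.2 | p in
    [set p : (X -> R) * (Y -> R) | measurable_fun [set: X] p.1 /\
                                   measurable_fun [set: Y] p.2]].

Let w0 z : (0 < w z)%R. Proof. by case/andP: (w01 z). Qed.

Lemma measurable_misfit phi psi :
  measurable_fun [set: X] phi -> measurable_fun [set: Y] psi ->
  measurable_fun [set: X * Y] (misfit phi psi).
Proof.
move=> mphi mpsi.
have m : measurable_fun [set: X * Y] (fun z => phi z.1 + psi z.2 - c z)%R.
  apply: measurable_funB => //.
  by apply: measurable_funD; exact: measurableT_comp.
apply: (@measurable_fun_ifT _ _ _ _ _ _ (fun z => z \in G)) => //.
  apply: (measurable_fun_bool true).
  rewrite setTI [X in measurable X](_ : _ = G)//; apply/seteqP.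
  by split=> z; [exact: set_mem|exact: mem_set].
exact: measurable_maxr.
Qed.

Lemma energy_ge0 phi psi : 0 <= energy phi psi.
Proof.
by apply: integral_ge0 => z _; rewrite lee_fin mulr_ge0 ?loss_ge0// ltW.
Qed.

Lemma min_energy_le phi psi :
  measurable_fun [set: X] phi -> measurable_fun [set: Y] psi ->
  min_energy <= energy phi psi.
Proof. by move=> mphi mpsi; apply: ereal_inf_lbound; exists (phi, psi). Qed.

Lemma measurable_loss_misfit phi psi :
  measurable_fun [set: X] phi -> measurable_fun [set: Y] psi ->
  measurable_fun [set: X * Y] (fun z => (w z * loss (misfit phi psi z))%:E).
Proof.
move=> mphi mpsi; apply/measurable_EFinP; apply: measurable_funM => //.
by apply: measurableT_comp measurable_loss _; exact: measurable_misfit.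
Qed.

Lemma min_energy_le1 : min_energy <= 1.
Proof.
(* The zero potentials have misfit at most [c] in absolute value, and [w * c <= 1]. *)
apply: (@le_trans _ _ (energy (cst 0%R) (cst 0%R))); first exact: min_energy_le.
apply: (@le_trans _ _ (\int[P]_z cst 1 z)); last first.
  by rewrite integral_cst// [X in _ * X]probability_setT mule1.
apply: ge0_le_integral => //.
- by move=> z _; rewrite lee_fin mulr_ge0 ?loss_ge0// ltW.
- exact: measurable_loss_misfit.
- move=> z _; rewrite lee_fin (le_trans _ (wc1 z))// ler_wpM2l//.
    exact: ltW.
  apply: le_trans (loss_le_norm _) _; apply: le_trans (norm_residual_le _ _) _.
  by rewrite /= addr0 sub0r normrN ger0_norm.
Qed.

Lemma min_energy_fin : min_energy \is a fin_num.
Proof.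
rewrite ge0_fin_numE; first by apply: le_lt_trans min_energy_le1 _; exact: ltry.
by apply: le_ereal_inf_tmp => _ [p _ <-]; exact: energy_ge0.
Qed.

(** Plays the part of the parallelogram identity in a projection theorem: the averaged potentials
    still cost at least [min_energy], so two near-minimisers have misfits with close [dloss]. *)
Lemma energy_midpoint phi psi phi' psi' :
  measurable_fun [set: X] phi -> measurable_fun [set: Y] psi ->
  measurable_fun [set: X] phi' -> measurable_fun [set: Y] psi' ->
  2%:E * min_energy + (4^-1)%:E *
  \int[P]_z (w z *
     (dloss (misfit phi psi z) - dloss (misfit phi' psi' z)) ^+ 2)%:E <=
  energy phi psi + energy phi' psi'.
Proof.
move=> mphi mpsi mphi' mpsi'.
pose phi2 x := ((phi x + phi' x) / 2)%R.
pose psi2 y := ((psi y + psi' y) / 2)%R.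
have mphi2 : measurable_fun [set: X] phi2.
  by apply: measurable_funM => //; exact: measurable_funD.
have mpsi2 : measurable_fun [set: Y] psi2.
  by apply: measurable_funM => //; exact: measurable_funD.
pose D z := (w z * (dloss (misfit phi psi z) - dloss (misfit phi' psi' z)) ^+ 2)%R.
have D0 z : 0 <= (D z)%:E by rewrite lee_fin mulr_ge0 ?sqr_ge0// ltW.
have mD : measurable_fun [set: X * Y] (fun z => (D z)%:E).
  apply/measurable_EFinP; apply: measurable_funM => //.
  apply: measurable_funX; apply: measurable_funB;
    by apply: measurableT_comp measurable_dloss _; exact: measurable_misfit.
have L0 f g z : 0 <= (w z * loss (misfit f g z))%:E.
  by rewrite lee_fin mulr_ge0 ?loss_ge0// ltW.
apply: (@le_trans _ _ (2%:E * energy phi2 psi2 + (4^-1)%:E * \int[P]_z (D z)%:E)).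
  by rewrite leeD2r// lee_pmul2l//; exact: min_energy_le.
rewrite /energy -!ge0_integralZl//; last exact: measurable_loss_misfit.
have mL : measurable_fun [set: X * Y]
    (fun z => 2%:E * (w z * loss (misfit phi2 psi2 z))%:E).
  by apply: emeasurable_funM => //; exact: measurable_loss_misfit.
have mD4 : measurable_fun [set: X * Y] (fun z => (4^-1)%:E * (D z)%:E).
  exact: emeasurable_funM.
rewrite -ge0_integralD//; last 2 first.
- by move=> z _; rewrite mule_ge0.
- by move=> z _; rewrite mule_ge0// lee_fin.
rewrite -ge0_integralD//; [|exact: measurable_loss_misfit..].
apply: ge0_le_integral => //.
- by move=> z _; rewrite adde_ge0// mule_ge0// lee_fin.
- exact: emeasurable_funD.
- by apply: emeasurable_funD; exact: measurable_loss_misfit.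
move=> z _; rewrite -!EFinM -!EFinD lee_fin /D.
rewrite [X in (X <= _)%R](_ : _ = (w z * (2 * loss (misfit phi2 psi2 z) +
  (dloss (misfit phi psi z) - dloss (misfit phi' psi' z)) ^+ 2 / 4))%R);
  last by ring.
rewrite -mulrDr ler_wpM2l//; first exact: ltW.
rewrite /misfit.
have -> : (phi2 z.1 + psi2 z.2 - c z =
  ((phi z.1 + psi z.2 - c z) + (phi' z.1 + psi' z.2 - c z)) / 2)%R.
  by rewrite /phi2 /psi2; field.
exact: loss_residual_midpoint.
Qed.

(** The tolerance [4^-n] at ranks [n] and [n.+1] makes the integral in [energy_midpoint] at most
    [8 / 4^n], the rate that [ae_cvg_dloss] asks for. *)
Lemma minimizing_sequence : exists (phi_ : (X -> R)^nat) (psi_ : (Y -> R)^nat),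
  [/\ forall n, measurable_fun [set: X] (phi_ n),
      forall n, measurable_fun [set: Y] (psi_ n),
      forall n, energy (phi_ n) (psi_ n) <=
                      min_energy + ((2 ^+ n) ^- 2)%:E &
      {ae P, forall z, cvgn (fun n => misfit (phi_ n) (psi_ n) z)}].
Proof.
have near n : {p : (X -> R) * (Y -> R) | [/\ measurable_fun [set: X] p.1,
    measurable_fun [set: Y] p.2 &
    energy p.1 p.2 <= min_energy + ((2 ^+ n) ^- 2)%:E]}.
  apply: cid.
  have e0 : (0 < (2 ^+ n) ^- 2 :> R)%R by rewrite invr_gt0 !exprn_gt0.
  have [_ [p [mp1 mp2] <-] /ltW pe] := lb_ereal_inf_adherent e0 min_energy_fin.
  by exists p.
pose phi_ n := (sval (near n)).1; pose psi_ n := (sval (near n)).2.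
have mphi n : measurable_fun [set: X] (phi_ n).
  by rewrite /phi_; case: (near n) => p [].
have mpsi n : measurable_fun [set: Y] (psi_ n).
  by rewrite /psi_; case: (near n) => p [].
have small n : energy (phi_ n) (psi_ n) <= min_energy + ((2 ^+ n) ^- 2)%:E.
  by rewrite /phi_ /psi_; case: (near n) => p [].
exists phi_, psi_; split => //.
have ma n := measurable_misfit (mphi n) (mpsi n).
have inv_le1 n : ((2 ^+ n) ^- 2 <= 1 :> R)%R.
  by rewrite invf_le1 ?exprn_gt0// !exprn_ege1// ler1n.
apply: (@ae_cvg_of_loss _ _ _ P w _ mw w01 ma 2).
  move=> n; apply: le_trans (small n) _.
  by rewrite (_ : 2 = 1 + 1)%R// EFinD leeD ?min_energy_le1// lee_fin.
apply: (@ae_cvg_dloss _ _ _ P w _ mw w01 ma) => n.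
have := energy_midpoint (mphi n) (mpsi n) (mphi n.+1) (mpsi n.+1).
set I := \int[P]_z _.
have I0 : 0 <= I 
  by apply: integral_ge0 => z _; rewrite lee_fin mulr_ge0 ?sqr_ge0// ltW.
move=> /le_trans/(_ (leeD (small n) (small n.+1))).
rewrite -(fineK min_energy_fin); case: I I0 => [r| |]//=; last first.
  by rewrite mulry gtr0_sg ?invr_gt0// mul1e addey// -!EFinD leye_eq.
rewrite !lee_fin => r0.
have : ((2 ^+ n.+1) ^- 2 <= (2 ^+ n) ^- 2 :> R)%R.
  rewrite lef_pV2 ?posrE ?exprn_gt0// ler_pXn2r ?nnegrE ?exprn_ge0//.
  by rewrite ler_weXn2l// ler1n.
lra.
Qed.

End energy.

(** * Upper and lower limits of bounded sequences *)

Section limn_sup_extra.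
Context {R : realType}.
Implicit Types u v : R^nat.

Lemma bounded_funP u : bounded_fun u <-> exists M, forall n, `|u n| <= M.
Proof.
split=> [/pinfty_ex_gt0[M M0 uM]|[M uM]]; first by exists M => n; exact: uM.
exists M; split; first exact: num_real.
by move=> K MK n _; rewrite /= (le_trans (uM n))// ltW.
Qed.

Lemma cvg_bounded u : cvgn u -> exists M, forall n, `|u n| <= M.
Proof. by move=> /cvg_seq_bounded/bounded_funP. Qed.

Lemma le_limn_sup u v : bounded_fun u -> bounded_fun v ->
  (forall n, u n <= v n) -> limn_sup u <= limn_sup v.
Proof.
move=> bu bv uv; apply: ler_lim.
- apply: nonincreasing_is_cvgn; last exact: bounded_fun_has_lbound_sups.
  exact/nonincreasing_sups/bounded_fun_has_ubound.
- apply: nonincreasing_is_cvgn; last exact: bounded_fun_has_lbound_sups.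
  exact/nonincreasing_sups/bounded_fun_has_ubound.
apply: nearW => n; apply: ge_sup; first by exists (u n); exists n => /=.
move=> _ [k /= nk <-]; apply: le_trans (uv k) _.
apply: ub_le_sup; last by exists k.
exact/has_ubound_sdrop/bounded_fun_has_ubound.
Qed.

Lemma limn_supD_cvg u v (l : R) : bounded_fun u -> v @ \oo --> l ->
  limn_sup (fun n => u n + v n) <= limn_sup u + l.
Proof.
move=> bu vl; have [_ <-] := cvg_limn_inf_sup vl.
apply: le_limn_supD => //; apply: cvg_seq_bounded; apply/cvg_ex.
by exists l.
Qed.

(** [- limn_sup (- v)] is the lower limit of [v]. From [u <= - v + (r + c)] with [r] converging to
    [l], the upper limit of [u] plus the lower limit of [v] is at most [l + c]. Under an equality
    constraint [- v = u - (r + c)] yields the converse. Two upper limits would not give the first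
    bound. *)
Lemma norm_residual_limn_sup b u v (c l : R) :
  bounded_fun u -> bounded_fun v ->
  (fun n => residual b (u n + v n - c)) @ \oo --> l ->
  `|residual b (limn_sup u - limn_sup (fun n => - v n) - c)| <= `|l|.
Proof.
move=> bu bv rl; set r := (fun n => _) in rl.
have bNv : bounded_fun (fun n => - v n) by exact: (bounded_funN bv).
have rcl : (fun n => r n + c) @ \oo --> l + c by apply: cvgD => //; exact: cvg_cst.
have bw : bounded_fun (fun n => - v n + (r n + c)).
  by apply: (bounded_funD bNv); apply: cvg_seq_bounded; apply/cvg_ex; exists (l + c).
have ule : limn_sup u <= limn_sup (fun n => - v n) + (l + c).
  apply: le_trans (limn_supD_cvg bNv rcl); apply: le_limn_sup => // n.
  by have := residual_le b (u n + v n - c); rewrite -/(r n); lra.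
case: b @r rl rcl bw ule => r rl rcl bw ule; last first.
  have l0 : 0 <= l.
    by apply: (cvgr_to_ge rl); apply: nearW => n; rewrite /r le_max lexx orbT.
  rewrite /residual !ger0_norm ?le_max ?lexx ?orbT// ge_max l0 andbT; lra.
have Nrcl : (fun n => - (r n + c)) @ \oo --> - (l + c) by exact: cvgN.
have vle : limn_sup (fun n => - v n) <= limn_sup u - (l + c).
  apply: le_trans (limn_supD_cvg bu Nrcl).
  have -> // : (fun n => - v n) = (fun n => u n - (r n + c)).
  by apply/funext => n; rewrite /r /=; ring.
rewrite /residual (_ : limn_sup u - _ - c = l)//; lra.
Qed.

End limn_sup_extra.

(** * Null sets of product measures and their sections *)

Section product_ae.
Local Open Scope ereal_scope.
Context {d1 d2 : measure_display} {X : measurableType d1}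
  {Y : measurableType d2} {R : realType}.
Variables (mu : probability X R) (nu : probability Y R).

Lemma ae_xsection (A : set (X * Y)) :
  {ae mu \x nu, forall z, A z} ->
  {ae mu, forall x, {ae nu, forall y, A (x, y)}}.
Proof.
move=> [N [mN N0 AN]].
have mf : measurable_fun [set: X] (fun x => nu (xsection N x)).
  exact: measurable_fun_xsection.
have : \int[mu]_x `|nu (xsection N x)| = 0.
  by under eq_integral => x _ do rewrite gee0_abs//.
move=> /(ae_eq_integral_abs _ measurableT mf); apply: filterS => x /(_ I) Nx.
exists (xsection N x); split => //; first exact: measurable_xsection.
by move=> y nA; rewrite /xsection/= inE; exact: AN.
Qed.

Lemma ae_ysection (A : set (X * Y)) :
  {ae mu \x nu, forall z, A z} ->
  {ae nu, forall y, {ae mu, forall x, A (x, y)}}.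
Proof.
move=> [N [mN N0 AN]].
have mf : measurable_fun [set: Y] (fun y => mu (ysection N y)).
  exact: measurable_fun_ysection.
have : \int[nu]_y `|mu (ysection N y)| = 0.
  under eq_integral => y _ do rewrite gee0_abs//.
  (* The product measure integrates [x]-sections. Integrating [y]-sections defines [\x^], which
     agrees with it by uniqueness. *)
  rewrite -[LHS]/((mu \x^ nu) N) -N0; apply/esym.
  by apply: product_measure_unique => // B C mB mC; exact: product_measure2E.
move=> /(ae_eq_integral_abs _ measurableT mf); apply: filterS => y /(_ I) Ny.
exists (ysection N y); split => //; first exact: measurable_ysection.
by move=> x nA; rewrite /ysection/= inE; exact: AN.
Qed.

Variable P : probability (X * Y)%type R.
Hypothesis P_ll : P `<< mu \x nu.

Lemma ae_fst (A : set X) : {ae mu, forall x, A x} -> {ae P, forall z, A z.1}.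
Proof.
move=> [N [mN N0 AN]]; exists (N `*` [set: Y]); split.
- exact: measurableX.
- have /null_content_dominatesP := P_ll; apply; first exact: measurableX.
  by rewrite [LHS]product_measure1E// [X in X * _]N0 mul0e.
- by move=> z nA; split => //; exact: AN.
Qed.

Lemma ae_snd (B : set Y) : {ae nu, forall y, B y} -> {ae P, forall z, B z.2}.
Proof.
move=> [N [mN N0 BN]]; exists ([set: X] `*` N); split.
- exact: measurableX.
- have /null_content_dominatesP := P_ll; apply; first exact: measurableX.
  by rewrite [LHS]product_measure1E// [X in _ * X]N0 mule0.
- by move=> z nB; split => //; exact: BN.
Qed.

Lemma ae_dominated (A : set (X * Y)) : mu \x nu `<< P ->
  {ae P, forall z, A z} -> {ae mu \x nu, forall z, A z}.
Proof.
move=> /null_content_dominatesP dom [N [mN N0 AN]]; exists N; split => //.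
exact: dom.
Qed.

End product_ae.

Section marginal_sections.
Local Open Scope ereal_scope.
Context {d1 d2 : measure_display} {X : measurableType d1}
  {Y : measurableType d2} {R : realType}.
Variables (mu : probability X R) (nu : probability Y R).
Variable Q : probability (X * Y)%type R.
Hypothesis Q_ll : Q `<< mu \x nu.
Variable G : set (X * Y).
Hypotheses (mG : measurable G) (QG : Q (~` G) = 0).

Let null_of_G (A : set (X * Y)) : measurable A ->
  (mu \x nu) (A `&` G) = 0 -> Q A = 0.
Proof.
move=> mA AG0; apply/eqP; rewrite -measure_le0 -[X in _ <= X]adde0.
have /null_content_dominatesP dom := Q_ll.
rewrite -[X in _ <= X + _](dom (A `&` G))//; last exact: measurableI.
rewrite -[X in _ <= _ + X]QG.
apply: le_trans (measureU2 _ _ _); [|exact: measurableI|exact: measurableC].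
apply: le_measure; rewrite ?inE//.
  by apply: measurableU; [exact: measurableI|exact: measurableC].
by move=> z Az; have [Gz|nGz] := pselect (G z); [left|right].
Qed.

(** Above the set [A] of exceptional points, [G] is null for the product measure. As [Q] is
    dominated by that measure and charges only [G], it gives no mass to [A] times [Y], and this mass
    is [mu A]. *)
Lemma ae_xsection_neq0 :
  (forall A, measurable A -> Q (fst @^-1` A) = mu A) ->
  {ae mu, forall x, ~ {ae nu, forall y, ~ G (x, y)}}.
Proof.
move=> Qfst; pose A := [set x | nu (xsection G x) = 0].
have mA : measurable A.
  rewrite /A -[X in measurable X]setTI.
  exact: (emeasurable_fun_eq measurableT (measurable_fun_xsection _ mG)).
exists A; split => //; last first.
  move=> x /= /contrapT [N [mN N0 GN]]; apply: (subset_measure0 _ mN _ N0).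
    exact: measurable_xsection.
  by move=> y; rewrite /xsection/= inE => Gxy; apply: GN => /=; exact.
rewrite -Qfst//; apply: null_of_G.
  by rewrite -[X in measurable X]setTI; exact: measurable_fst.
rewrite [LHS]integral0_eq// => x _ /=.
have [Ax|nAx] := pselect (A x).
  rewrite -[RHS]Ax; congr (nu _); apply/seteqP.
  by split=> y; rewrite /xsection/= !inE; [case|].
rewrite (_ : xsection _ x = set0) ?measure0//; apply/seteqP.
by split=> y //; rewrite /xsection/= inE => -[].
Qed.

Lemma ae_ysection_neq0 :
  (forall B, measurable B -> Q (snd @^-1` B) = nu B) ->
  {ae nu, forall y, ~ {ae mu, forall x, ~ G (x, y)}}.
Proof.
move=> Qsnd; pose B := [set y | mu (ysection G y) = 0].
have mB : measurable B.
  rewrite /B -[X in measurable X]setTI.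
  exact: (emeasurable_fun_eq measurableT (measurable_fun_ysection _ mG)).
exists B; split => //; last first.
  move=> y /= /contrapT [N [mN N0 GN]]; apply: (subset_measure0 _ mN _ N0).
    exact: measurable_ysection.
  by move=> x; rewrite /ysection/= inE => Gxy; apply: GN => /=; exact.
have msB : measurable (snd @^-1` B : set (X * Y)).
  by rewrite -[X in measurable X]setTI; exact: measurable_snd.
rewrite -Qsnd//; apply: null_of_G => //.
have -> : (mu \x nu) (snd @^-1` B `&` G) = (mu \x^ nu) (snd @^-1` B `&` G).
  apply: product_measure_unique; last exact: measurableI.
  by move=> C D mC mD; exact: product_measure2E.
rewrite [LHS]integral0_eq// => y _ /=.
have [By|nBy] := pselect (B y).
  rewrite -[RHS]By; congr (mu _); apply/seteqP.
  by split=> x; rewrite /ysection/= !inE; [case|].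
rewrite (_ : ysection _ y = set0) ?measure0//; apply/seteqP.
by split=> x //; rewrite /ysection/= inE => -[].
Qed.

End marginal_sections.

(** * Existence of minimising potentials *)

Section minimizer.
Local Open Scope ereal_scope.
Context {d1 d2 : measure_display} {X : measurableType d1}
  {Y : measurableType d2} {R : realType}.
Variables (mu : probability X R) (nu : probability Y R).
Variable P : probability (X * Y)%type R.
Hypotheses (P_ll : P `<< mu \x nu) (ll_P : mu \x nu `<< P).
Variables (G : set (X * Y)) (c w : X * Y -> R).
Hypothesis mG : measurable G.
Hypothesis mc : measurable_fun [set: X * Y] c.
Hypothesis mw : measurable_fun [set: X * Y] w.
Hypothesis c0 : forall z, (0 <= c z)%R.
Hypothesis w01 : forall z, (0 < w z <= 1)%R.
Hypothesis wc1 : forall z, (w z * c z <= 1)%R.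
Hypothesis G_neq0 : ~ {ae P, forall z, ~ G z}.
Hypothesis Gx : {ae mu, forall x, ~ {ae nu, forall y, ~ G (x, y)}}.
Hypothesis Gy : {ae nu, forall y, ~ {ae mu, forall x, ~ G (x, y)}}.

(* Along a sequence of sums [phi_ n x + psi_ n y] only the misfits converge. As
   the sums are controlled by the misfits, exactly on [G] and from above
   elsewhere, after normalisation at one point [(x0, y0)] of [G] both sequences
   are almost everywhere bounded. Taking [limsup phi_ n] and [liminf psi_ n] then
   keeps the equality on [G] and the inequality elsewhere. *)
Lemma misfit_limit (phi_ : (X -> R)^nat) (psi_ : (Y -> R)^nat) :
  (forall n, measurable_fun [set: X] (phi_ n)) ->
  (forall n, measurable_fun [set: Y] (psi_ n)) ->
  {ae P, forall z, cvgn (fun n => misfit G c (phi_ n) (psi_ n) z)} ->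
  exists phi psi, [/\ measurable_fun [set: X] phi, measurable_fun [set: Y] psi &
    {ae P, forall z, (`|misfit G c phi psi z| <=
                      `|limn (fun n => misfit G c (phi_ n) (psi_ n) z)|)%R}].
Proof.
move=> mphi mpsi aecv.
pose good z := cvgn (fun n => misfit G c (phi_ n) (psi_ n) z).
have aegood : {ae mu \x nu, forall z, good z} by exact: ae_dominated aecv.
have goodx := ae_xsection aegood; have goody := ae_ysection aegood.
(* Every condition on the base point except membership in [G] holds [P]-almost everywhere, and [G]
   is not [P]-null. *)
have [[x0 y0] /= [G0 [good0 [gx0 gy0]]]] : exists z, G z /\ (good z /\
    {ae nu, forall y, good (z.1, y)} /\ {ae mu, forall x, good (x, z.2)}).
  apply: contrapT => noz; apply: G_neq0.
  have := ae_fst P_ll goodx; have := ae_snd P_ll goody.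
  apply: filterS3 aecv => z gz gy gx Gz; apply: noz; exists z.
  by split => //; split.
(* Moving the constant [phi_ n x0] from one potential to the other leaves all misfits unchanged and
   makes [u n x0 = 0]. *)
pose u n x := (phi_ n x - phi_ n x0)%R.
pose v n y := (psi_ n y + phi_ n x0)%R.
have misfitE n x y : misfit G c (phi_ n) (psi_ n) (x, y) =
    residual ((x, y) \in G) (u n x + v n y - c (x, y)).
  by rewrite /misfit /= /u /v; congr (residual _ _); ring.
have ub x y : good (x, y) ->
    exists M : R, forall n, (u n x + v n y <= M)%R.
  move=> /cvg_bounded[M Mn]; exists (M + c (x, y))%R => n.
  rewrite -lerBlDr (le_trans (residual_le ((x, y) \in G) _))//.
  by rewrite -misfitE (le_trans (ler_norm _))//; exact: Mn.
have lb x y : good (x, y) -> G (x, y) ->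
    exists M : R, forall n, (- M <= u n x + v n y)%R.
  move=> /cvg_bounded[M Mn] Gxy; exists (M - c (x, y))%R => n.
  have := Mn n; rewrite misfitE (mem_set Gxy) /= ler_norml => /andP[+ _].
  lra.
have u0 n : u n x0 = 0%R by rewrite /u subrr.
have [V0 v0] : exists M : R, forall n, (`|v n y0| <= M)%R.
  have [M1 vM1] := ub _ _ good0; have [M2 vM2] := lb _ _ good0 G0.
  exists (Num.max M1 M2) => n; rewrite ler_norml le_max lerNl le_max.
  have := vM1 n; have := vM2 n; rewrite u0 add0r => ? ?.
  by apply/andP; split; apply/orP; [right|left]; lra.
have ubu x : good (x, y0) -> exists M : R, forall n, (u n x <= M)%R.
  move=> /ub[M uM]; exists (M + V0)%R => n.
  have := uM n; have := v0 n; rewrite ler_norml => /andP[? _]; lra.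
have ubv y : good (x0, y) -> exists M : R, forall n, (v n y <= M)%R.
  by move=> /ub[M vM]; exists M => n; have := vM n; rewrite u0 add0r.
have bu : {ae mu, forall x, bounded_fun (u ^~ x)}.
  apply: filterS3 Gx goodx gy0 => x nGx gx gxy0.
  (* The upper bound on [u n x] comes from [(x, y0)]. For the lower bound take [y] with [(x, y)] in
     [G]: the sum is bounded below there, and [v n y] is bounded above through [x0]. *)
  have [y [Gxy gxy gx0y]] : exists y, [/\ G (x, y), good (x, y) & good (x0, y)].
    apply: contrapT => noy; apply: nGx.
    by apply: filterS2 gx gx0 => y ? ? ?; apply: noy; exists y.
  have [M1 uM1] := ubu _ gxy0; have [M2 vM2] := ubv _ gx0y.
  have [M3 uvM3] := lb _ _ gxy Gxy.
  apply/bounded_funP; exists (Num.max M1 (M2 + M3))%R => n.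
  rewrite ler_norml le_max lerNl le_max.
  have := uM1 n; have := vM2 n; have := uvM3 n => ? ? ?.
  by apply/andP; split; apply/orP; [right|left]; lra.
have bv : {ae nu, forall y, bounded_fun (v ^~ y)}.
  apply: filterS3 Gy goody gx0 => y nGy gy gx0y.
  have [x [Gxy gxy gxy0]] : exists x, [/\ G (x, y), good (x, y) & good (x, y0)].
    apply: contrapT => nox; apply: nGy.
    by apply: filterS2 gy gy0 => x ? ? ?; apply: nox; exists x.
  have [M1 uM1] := ubu _ gxy0; have [M2 vM2] := ubv _ gx0y.
  have [M3 uvM3] := lb _ _ gxy Gxy.
  apply/bounded_funP; exists (Num.max M2 (M1 + M3))%R => n.
  rewrite ler_norml le_max lerNl le_max.
  have := uM1 n; have := vM2 n; have := uvM3 n => ? ? ?.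
  by apply/andP; split; apply/orP; [right|left]; lra.
have [NX [mNX NX0 bNX]] := bu; have [NY [mNY NY0 bNY]] := bv.
(* Zeroing the sequences on null sets makes them bounded at every point, as the measurability of
   [limn_sup] requires. *)
pose u' n x := (u n x * \1_(~` NX) x)%R.
pose v' n y := (v n y * \1_(~` NY) y)%R.
have mu' n : measurable_fun [set: X] (u' n).
  apply: measurable_funM; first exact: measurable_funB.
  by apply: measurable_indic; exact: measurableC.
have mv' n : measurable_fun [set: Y] (v' n).
  apply: measurable_funM; first exact: measurable_funD.
  by apply: measurable_indic; exact: measurableC.
have u'E x : (~` NX) x -> u' ^~ x = u ^~ x.
  by move=> Nx; apply/funext => n; rewrite /u' indicE mem_set// mulr1.
have v'E y : (~` NY) y -> v' ^~ y = v ^~ y.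
  by move=> Ny; apply/funext => n; rewrite /v' indicE mem_set// mulr1.
have bounded0 : bounded_fun (fun _ : nat => 0 : R)%R.
  by apply/bounded_funP; exists 0%R => n; rewrite normr0.
have bu' x : bounded_fun (u' ^~ x).
  have [Nx|Nx] := pselect (NX x); last first.
    by rewrite u'E//; apply: contrapT => nb; apply: Nx; exact: bNX.
  rewrite (_ : u' ^~ x = fun=> 0%R)//; apply/funext => n.
  by rewrite /u' indicE memNset ?mulr0//= => /(_ Nx).
have bv' y : bounded_fun (v' ^~ y).
  have [Ny|Ny] := pselect (NY y); last first.
    by rewrite v'E//; apply: contrapT => nb; apply: Ny; exact: bNY.
  rewrite (_ : v' ^~ y = fun=> 0%R)//; apply/funext => n.
  by rewrite /v' indicE memNset ?mulr0//= => /(_ Ny).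
exists (fun x => limn_sup (u' ^~ x)).
exists (fun y => - limn_sup (fun n => - v' n y))%R; split.
- apply: measurable_fun_limn_sup => // x _.
    exact: bounded_fun_has_ubound.
  exact: bounded_fun_has_lbound.
- apply: measurableT_comp => //; apply: measurable_fun_limn_sup => [y _|y _|n].
  + exact/bounded_fun_has_ubound/bounded_funN.
  + exact/bounded_fun_has_lbound/bounded_funN.
  + exact: measurableT_comp.
have aeNX : {ae mu, forall x, (~` NX) x}.
  by exists NX; split => // x /=; rewrite notK.
have aeNY : {ae nu, forall y, (~` NY) y}.
  by exists NY; split => // y /=; rewrite notK.
have := ae_fst P_ll aeNX; have := ae_snd P_ll aeNY.
apply: filterS3 aecv => -[x y] /= cv Ny Nx.
apply: (norm_residual_limn_sup (bu' x) (bv' y)).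
apply: cvg_trans cv; rewrite [X in X `=>` _](_ : _ =
  (fun n => misfit G c (phi_ n) (psi_ n) (x, y)) @ \oo)//.
congr (_ @ \oo); apply/funext => n; rewrite misfitE.
have -> : u' n x = u n x by rewrite -[LHS]/((u' ^~ x) n) u'E.
by have -> : v' n y = v n y by rewrite -[LHS]/((v' ^~ y) n) v'E.
Qed.

(** Direct method: the misfit of the limit potentials is dominated by the limit of the misfits, and
    Fatou bounds the resulting energy by the lower limit of the energies, which is [min_energy]. *)
Lemma exists_minimizer : exists phi psi,
  [/\ measurable_fun [set: X] phi, measurable_fun [set: Y] psi &
      energy P G c w phi psi = min_energy P G c w].
Proof.
have [phi_ [psi_ [mphi_ mpsi_ near cv]]] :=
  minimizing_sequence P mG mc mw c0 w01 wc1.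
have [phi [psi [mphi mpsi le_lim]]] := misfit_limit mphi_ mpsi_ cv.
exists phi, psi; split => //; apply/eqP; rewrite eq_le min_energy_le// andbT.
pose f n z := (w z * loss (misfit G c (phi_ n) (psi_ n) z))%:E.
have mf n : measurable_fun [set: X * Y] (f n) by exact: measurable_loss_misfit.
have w0 z : (0 <= w z)%R by case/andP: (w01 z) => /ltW.
have f0 n z : 0 <= f n z by rewrite lee_fin mulr_ge0 ?loss_ge0.
apply: (@le_trans _ _ (\int[P]_z limn_einf (f ^~ z))).
  apply: ae_ge0_le_integral => //.
  - by move=> z _; rewrite lee_fin mulr_ge0 ?loss_ge0.
  - exact: measurable_loss_misfit.
  - by move=> z _; exact: limn_einf_ge.
  - exact: measurable_fun_limn_einf.
  apply: filterS2 cv le_lim => z cvz lez _.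
  set l := limn _ in lez.
  have fl : f ^~ z @ \oo --> (w z * loss l)%:E.
    apply: cvg_EFin; first exact: nearW.
    apply: cvgM; first exact: cvg_cst.
    by apply: continuous_cvg => //; exact: loss_continuous.
  by have [-> _] := cvg_limn_einf_sup fl; rewrite lee_fin ler_wpM2l// le_loss_norm.
apply: le_trans (@fatou _ _ _ P _ measurableT _ mf (fun n z _ => f0 n z)) _.
have geo : (fun n => (2 ^+ n) ^- 2 : R)%R @ \oo --> (0%R : R).
  rewrite (_ : (fun n => _) = geometric 1 (4^-1))%R.
    by apply: cvg_geometric; rewrite ger0_norm// invf_lt1// ltr1n.
  apply/funext => n; rewrite /geometric /= mul1r exprVn -exprM mulnC exprM.
  by congr (_ ^+ _)^-1%R; rewrite -natrX.
have e0 : (fun n => min_energy P G c w + ((2 ^+ n) ^- 2)%:E) @ \oo -->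
    min_energy P G c w.
  rewrite -[X in _ --> X]adde0; apply: cvgeD.
  - by rewrite fin_num_adde_defl.
  - exact: cvg_cst.
  by apply: cvg_EFin; [exact: nearW|exact: geo].
have [<- _] := cvg_limn_einf_sup e0.
rewrite !limn_einf_lim; apply: lee_lim; [exact: is_cvg_einfs..|].
apply: nearW => n; apply: le_ereal_inf_tmp => _ [k nk <-].
apply: le_trans (near k); apply: ereal_inf_lbound; by exists k.
Qed.

End minimizer.

(** * First-order conditions *)

Lemma bounded_integrable d (T : measurableType d) (R : realType)
    (P : probability T R) (f : T -> R) (M : R) :
  measurable_fun [set: T] f -> (forall z, `|f z| <= M) ->
  P.-integrable [set: T] (EFin \o f).
Proof.
move=> mf fM; apply: measurable_bounded_integrable => //.
  by rewrite [X in (X < _)%E]probability_setT ltry.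
exists M; split; first exact: num_real.
by move=> K MK z _; exact: le_trans (fM z) (ltW MK).
Qed.

Section first_order.
Local Open Scope ereal_scope.
Context {d1 d2 : measure_display} {X : measurableType d1}
  {Y : measurableType d2} {R : realType}.
Variable P : probability (X * Y)%type R.
Variables (G : set (X * Y)) (c w : X * Y -> R).
Hypothesis mG : measurable G.
Hypothesis mc : measurable_fun [set: X * Y] c.
Hypothesis mw : measurable_fun [set: X * Y] w.
Hypothesis c0 : forall z, (0 <= c z)%R.
Hypothesis w01 : forall z, (0 < w z <= 1)%R.
Hypothesis wc1 : forall z, (w z * c z <= 1)%R.
Variables (phi : X -> R) (psi : Y -> R).
Hypothesis mphi : measurable_fun [set: X] phi.
Hypothesis mpsi : measurable_fun [set: Y] psi.
Hypothesis minimal : energy P G c w phi psi = min_energy P G c w.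

Let a := misfit G c phi psi.
Let l z := (w z * loss (a z))%R.
Let g z := (w z * dloss (a z))%R.

Let w0 z : (0 < w z)%R. Proof. by case/andP: (w01 z). Qed.
Let w1 z : (w z <= 1)%R. Proof. by case/andP: (w01 z). Qed.

Let ma : measurable_fun [set: X * Y] a. Proof. exact: measurable_misfit. Qed.

Let mg : measurable_fun [set: X * Y] g.
Proof.
by apply: measurable_funM => //; exact: measurableT_comp measurable_dloss ma.
Qed.

Let gw z : (`|g z| <= w z)%R.
Proof. by rewrite normrM gtr0_norm// ler_piMr ?norm_dloss_le1// ltW. Qed.

Let int_l : P.-integrable [set: X * Y] (EFin \o l).
Proof.
apply/integrableP; split; first exact: measurable_loss_misfit.
rewrite (_ : \int[P]_x _ = energy P G c w phi psi).
  by rewrite minimal ltey_eq min_energy_fin.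
by apply: eq_integral => z _; rewrite gee0_abs// lee_fin mulr_ge0 ?loss_ge0// ltW.
Qed.

Let energyE : \int[P]_z (l z)%:E = min_energy P G c w.
Proof. exact: minimal. Qed.

(** The competing potentials cost at least [min_energy]. Since [l] attains this finite value, it
    cancels and leaves the integral of [k], for any integrable majorant [l + k] of their weighted
    loss. *)
Let variation phi' psi' k :
  measurable_fun [set: X] phi' -> measurable_fun [set: Y] psi' ->
  P.-integrable [set: X * Y] (EFin \o k) ->
  (forall z, w z * loss (misfit G c phi' psi' z) <= l z + k z)%R ->
  0 <= \int[P]_z (k z)%:E.
Proof.
move=> mphi' mpsi' ik le_k.
have mk : measurable_fun [set: X * Y] k.
  by apply/measurable_EFinP; exact: measurable_int ik.
have vbound : min_energy P G c w <= \int[P]_z (l z + k z)%:E.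
  apply: (le_trans (min_energy_le P G c w mphi' mpsi')).
  apply: ge0_le_integral => //.
  - by move=> z _; rewrite lee_fin mulr_ge0 ?loss_ge0// ltW.
  - exact: measurable_loss_misfit.
  - apply/measurable_EFinP; apply: measurable_funD => //.
    by apply/measurable_EFinP; exact: measurable_int int_l.
  - by move=> z _; rewrite lee_fin.
have fin_k : \int[P]_z (k z)%:E \is a fin_num.
  exact: (integrable_fin_num measurableT ik).
move: vbound; rewrite [leRHS](integralD_EFin measurableT int_l ik).
rewrite [X in X + _]energyE.
rewrite -(fineK (min_energy_fin P mG mc mw c0 w01 wc1)) -(fineK fin_k).
by rewrite -EFinD !lee_fin lerDl.
Qed.

(** Both signs of [t] are allowed when the potentials move by [t * al] and [t * be], and the bound
    on the sum keeps the remainder below [t ^ 2 / 2]. With an indicator and the zero function this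
    says that [g] has null marginals. *)
Lemma first_order_marginals (al : X -> R) (be : Y -> R) :
  measurable_fun [set: X] al -> measurable_fun [set: Y] be ->
  (forall z, `|al z.1 + be z.2| <= 1)%R ->
  \int[P]_z (g z * (al z.1 + be z.2))%:E = 0.
Proof.
move=> mal mbe ab1.
have mab : measurable_fun [set: X * Y] (fun z => al z.1 + be z.2)%R.
  by apply: measurable_funD; exact: measurableT_comp.
pose k z := (g z * (al z.1 + be z.2))%R.
have ik : P.-integrable [set: X * Y] (EFin \o k).
  apply: (@bounded_integrable _ _ _ _ _ 1%R); first exact: measurable_funM.
  move=> z; rewrite normrM -[leRHS]mulr1 ler_pM//.
  by rewrite (le_trans (gw z)).
have ih (t : R) : P.-integrable [set: X * Y] (EFin \o fun=> (t ^+ 2 / 2)%R).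
  by apply: (@bounded_integrable _ _ _ _ _ `|t ^+ 2 / 2|%R).
pose m := fine (\int[P]_z (k z)%:E).
have mE : \int[P]_z (k z)%:E = m%:E by rewrite fineK// integrable_fin_num.
(* At [t = - m] the inequality reads [- m ^ 2 / 2 >= 0]. *)
suff quad t : (0 <= t * m + t ^+ 2 / 2)%R.
  rewrite mE; congr (_%:E); have := quad (- m)%R.
  rewrite sqrrN mulNr -expr2 => q; apply/eqP; rewrite -sqrf_eq0.
  by rewrite eq_le sqr_ge0 andbT; lra.
have itk : P.-integrable [set: X * Y] (EFin \o fun z => (t * k z)%R).
  by rewrite (_ : _ \o _ = fun z => t%:E * (k z)%:E)//; exact: integrableZl.
have := @variation (fun x => phi x + t * al x)%R (fun y => psi y + t * be y)%R
  (fun z => t * k z + t ^+ 2 / 2)%R.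
have -> : \int[P]_z (t * k z + t ^+ 2 / 2)%:E = (t * m + t ^+ 2 / 2)%:E.
  rewrite (integralD_EFin measurableT itk (ih t)).
  rewrite (_ : \int[P]_x _ = t%:E * m%:E); last first.
    by under eq_integral do rewrite /= EFinM; rewrite integralZl// mE.
  by rewrite integral_cst// [X in _ + _ * X]probability_setT mule1.
rewrite lee_fin; apply.
- by apply: measurable_funD => //; exact: measurable_funM.
- by apply: measurable_funD => //; exact: measurable_funM.
- exact: (integrableD measurableT itk (ih t)).
move=> z; pose e := (al z.1 + be z.2)%R.
have -> : misfit G c (fun x => phi x + t * al x)%R (fun y => psi y + t * be y)%R z =
    residual (z \in G) (phi z.1 + psi z.2 - c z + t * e)%R.
  by rewrite /misfit /e; congr (residual _ _); ring.
apply: le_trans (ler_wpM2l (ltW (w0 z)) (loss_residual_upper _ _ _)) _.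
rewrite -/(misfit G c phi psi z) -/(a z) /k /g /l -/e.
have e2 : (e ^+ 2 <= 1)%R.
  by rewrite -(real_normK (num_real e)) expr_le1 ?normr_ge0//; exact: ab1.
have : (w z * (t * e) ^+ 2 <= t ^+ 2)%R.
  have te : (0 <= (t * e) ^+ 2)%R by exact: sqr_ge0.
  apply: (@le_trans _ _ ((t * e) ^+ 2)%R); first by rewrite ler_piMl.
  by rewrite exprMn ler_piMr// sqr_ge0.
have -> : (w z * (loss (a z) + dloss (a z) * (t * e) + (t * e) ^+ 2 / 2) =
  w z * loss (a z) + t * (w z * dloss (a z) * e) + w z * (t * e) ^+ 2 / 2)%R.
  by ring.
lra.
Qed.

Let dom z := (w z * (`|a z| + c z))%R.

Let int_dom : P.-integrable [set: X * Y] (EFin \o dom).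
Proof.
have i2 : P.-integrable [set: X * Y] (EFin \o fun=> 2%R).
  exact: (@bounded_integrable _ _ _ _ _ `|2|%R).
(* One unit pays for [|a| <= loss a + 1] weighted by [w <= 1], the other for [w * c <= 1]. *)
apply: (@le_integrable _ _ _ P _ measurableT _ (EFin \o (fun z => l z + 2)%R)).
- apply/measurable_EFinP; apply: measurable_funM => //.
  by apply: measurable_funD => //; exact: measurableT_comp.
- move=> z _ /=; rewrite lee_fin.
  have d0 : (0 <= dom z)%R by rewrite mulr_ge0 ?addr_ge0// ltW.
  have l0 : (0 <= l z)%R by rewrite mulr_ge0 ?loss_ge0// ltW.
  rewrite !ger0_norm ?addr_ge0// /dom mulrDr.
  apply: (@le_trans _ _ (w z * (loss (a z) + 1) + 1))%R; last first.
    by rewrite mulrDr mulr1 -addrA lerD2l; have := w1 z; lra.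
  by rewrite lerD// ler_wpM2l ?norm_le_loss// ltW.
exact: (integrableD measurableT int_l i2).
Qed.

(* The variation of the energy along [(1 - r) (phi, psi)]. The sum [phi + psi]
   need not be integrable, but [loss_residual_shrink] provides a dominating
   function for the difference quotients. *)
Lemma first_order_scaling : 0 <= \int[P]_z (- (g z * (a z + c z)))%:E.
Proof.
pose u z := (phi z.1 + psi z.2)%R.
have mu : measurable_fun [set: X * Y] u.
  by apply: measurable_funD; exact: measurableT_comp.
pose r n : R := (n.+1%:R^-1)%R.
have r0 n : (0 < r n)%R by rewrite invr_gt0.
(* Divided by [r n], the change of the weighted loss is below [w] times each entry of the minimum.
   The first, from [loss_residual_shrink], gives the domination; the second, from
   [loss_residual_upper], tends to the derivative. *)
pose f n z := (w z * Num.min (`|a z| + c z)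
  (- (dloss (a z) * u z) + r n * u z ^+ 2 / 2))%R.
have mf n : measurable_fun [set: X * Y] (f n).
  apply: measurable_funM => //; apply: measurable_minr.
    by apply: measurable_funD => //; exact: measurableT_comp.
  apply: measurable_funD.
    apply: measurableT_comp => //; apply: measurable_funM => //.
    exact: measurableT_comp measurable_dloss ma.
  apply: measurable_funM => //; apply: measurable_funM => //.
  exact: measurable_funX.
have du z : (dloss (a z) * u z = dloss (a z) * (a z + c z))%R.
  exact: dloss_residual_mul.
have norm_du z : (`|dloss (a z) * u z| <= `|a z| + c z)%R.
  rewrite du normrM -[leRHS]mul1r ler_pM ?norm_dloss_le1//.
  by rewrite (le_trans (ler_normD _ _))// (ger0_norm (c0 z)).
have f_dom n z : (`|f n z| <= dom z)%R.
  rewrite normrM gtr0_norm// ler_wpM2l//; first exact: ltW.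
  have p : (0 <= r n * u z ^+ 2 / 2)%R.
    by rewrite divr_ge0// mulr_ge0 ?sqr_ge0// ltW.
  have := norm_du z; rewrite ler_norml => /andP[d1' d2'].
  have ac : (0 <= `|a z| + c z)%R by rewrite addr_ge0.
  rewrite ler_norml ge_min lexx /= andbT le_min; apply/andP; split; lra.
have if_ n : P.-integrable [set: X * Y] (EFin \o f n).
  apply: (@le_integrable _ _ _ P _ measurableT _ (EFin \o dom)) => //.
    exact/measurable_EFinP.
  move=> z _ /=; rewrite lee_fin (le_trans (f_dom n z))//.
  exact: ler_norm.
have f_ge0 n : 0 <= \int[P]_z (f n z)%:E.
  have irf : P.-integrable [set: X * Y] (EFin \o fun z => (r n * f n z)%R).
    exact: (integrableZl measurableT (r n) (if_ n)).
  suff : 0 <= \int[P]_z (r n * f n z)%:E.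
    under eq_integral do rewrite EFinM.
    by rewrite (integralZl measurableT (if_ n)) pmule_rge0 ?lte_fin.
  apply: (@variation (fun x => (1 - r n) * phi x)%R
    (fun y => (1 - r n) * psi y)%R) => //.
  - exact: measurable_funM.
  - exact: measurable_funM.
  move=> z.
  have -> : misfit G c (fun x => (1 - r n) * phi x)%R
      (fun y => (1 - r n) * psi y)%R z = residual (z \in G) ((1 - r n) * u z - c z)%R.
    by rewrite /misfit /u; congr (residual _ _); ring.
  have rn1 : (r n <= 1)%R by rewrite invf_le1// ler1n.
  have r01 : (0 <= r n <= 1)%R by rewrite ltW.
  have h1 := loss_residual_shrink (z \in G) (u z) (c0 z) r01.
  have h2 := loss_residual_upper (z \in G) (u z - c z) (- (r n * u z)).
  rewrite (_ : _ + - (r n * u z) = (1 - r n) * u z - c z)%R in h2; last by ring.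
  rewrite -/(misfit G c phi psi z) -/(a z) in h1 h2.
  rewrite /l /f mulrCA -mulrDr ler_wpM2l//; first exact: ltW.
  rewrite -lerBlDl -ler_pdivrMl// le_min !ler_pdivrMl//; apply/andP; split => //.
  by rewrite lerBlDr; apply: le_trans h2 _; nra.
pose f0 z := (- (w z * (dloss (a z) * u z)))%R.
have mf0 : measurable_fun [set: X * Y] f0.
  apply: measurableT_comp => //; apply: measurable_funM => //.
  by apply: measurable_funM => //; exact: measurableT_comp measurable_dloss ma.
have -> : \int[P]_z (- (g z * (a z + c z)))%:E = \int[P]_z (f0 z)%:E.
  by apply: eq_integral => z _; rewrite /f0 du /g mulrA.
have [||||_ _ cv] := @dominated_convergence _ _ _ P _ measurableT
    (fun n z => (f n z)%:E) (fun z => (f0 z)%:E) (fun z => (dom z)%:E) _ _ _ int_dom.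
- by move=> n; exact/measurable_EFinP.
- exact/measurable_EFinP.
- apply: aeW => z _; apply: cvg_EFin; first exact: nearW.
  have -> : f0 z = (w z * Num.min (`|a z| + c z)
      (- (dloss (a z) * u z) + 0 * u z ^+ 2 / 2))%R.
    rewrite mul0r mul0r addr0 (min_idPr _) ?mulrN//.
    by have := norm_du z; rewrite ler_norml => /andP[? _]; lra.
  have cr : (fun n => r n) @ \oo --> (0%R : R) by exact: cvg_harmonic.
  have cB : (fun n => - (dloss (a z) * u z) + r n * u z ^+ 2 / 2)%R @ \oo -->
      (- (dloss (a z) * u z) + 0 * u z ^+ 2 / 2)%R.
    apply: cvgD; first exact: cvg_cst.
    by apply: cvgM; [apply: cvgM => //; exact: cvg_cst|exact: cvg_cst].
  apply: cvgM; first exact: cvg_cst.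
  under eq_fun do rewrite minr_absE; rewrite minr_absE.
  apply: cvgM; last exact: cvg_cst.
  apply: cvgB; first by apply: cvgD => //; exact: cvg_cst.
  by apply: cvg_norm; apply: cvgB => //; exact: cvg_cst.
- by apply: aeW => z n _; rewrite lee_fin.
rewrite -(cvg_lim _ cv)//; apply: lime_ge; first by apply/cvg_ex; eexists; exact: cv.
exact: nearW.
Qed.

Lemma minimizer_misfit0 : 0 <= \int[P]_z (g z * c z)%:E ->
  {ae P, forall z, a z = 0%R}.
Proof.
move=> opt.
have mga : measurable_fun [set: X * Y] (fun z => g z * a z)%R.
  exact: measurable_funM.
have ga0 z : (0 <= g z * a z)%R.
  rewrite /g -mulrA mulr_ge0//; first exact: ltW.
  by have [->|/dloss_mul_gt0/ltW//] := eqVneq (a z) 0%R; rewrite mulr0.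
have iga : P.-integrable [set: X * Y] (EFin \o (fun z => g z * a z)%R).
  apply: (@le_integrable _ _ _ P _ measurableT _ (EFin \o dom)) => //.
    exact/measurable_EFinP.
  move=> z _ /=; rewrite lee_fin normrM; apply: le_trans (ler_norm _).
  by apply: ler_pM => //; rewrite lerDl.
have igc : P.-integrable [set: X * Y] (EFin \o (fun z => g z * c z)%R).
  apply: (@bounded_integrable _ _ _ _ _ 1%R); first exact: measurable_funM.
  move=> z; rewrite normrM (ger0_norm (c0 z)) (le_trans _ (wc1 z))//.
  by rewrite ler_wpM2r.
have := first_order_scaling.
have -> : \int[P]_z (- (g z * (a z + c z)))%:E =
    \int[P]_z ((-1)%:E * (g z * a z + g z * c z)%:E).
  by apply: eq_integral => z _; rewrite -EFinM mulN1r mulrDr.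
rewrite integralZl//; last exact: (integrableD measurableT iga igc).
rewrite (integralD_EFin measurableT iga igc).
have fga := integrable_fin_num measurableT iga.
have fgc := integrable_fin_num measurableT igc.
move: opt; rewrite -(fineK fga) -(fineK fgc) -EFinD -EFinM !lee_fin mulN1r.
move=> opt shr.
have ga_eq0 : \int[P]_z `|(g z * a z)%:E| = 0.
  apply/eqP; rewrite eq_le integral_ge0// andbT.
  under eq_integral do rewrite gee0_abs ?lee_fin//.
  by rewrite -(fineK fga) lee_fin; lra.
have mEga : measurable_fun [set: X * Y] (fun z => (g z * a z)%:E).
  exact/measurable_EFinP.
move/(ae_eq_integral_abs _ measurableT mEga): ga_eq0.
apply: filterS => z /(_ I) [ga]; apply/eqP; apply: contra_eqT ga => az.
by rewrite /g -mulrA gt_eqF// mulr_gt0// dloss_mul_gt0.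
Qed.

End first_order.

(** * Admissible cost functions *)

Section admissible_theory.
Context {R : realType}.
Variable h : R -> R.
Hypothesis h_adm : admissible h.
Implicit Types x y : R.

Local Notation dh := (deriv_ext h).

Lemma deriv_ext0 : dh 0 = 0.
Proof. by rewrite /deriv_ext ltxx; exact: cvg_lim (adm_deriv_at0 h_adm). Qed.

Lemma deriv_ext_ge0 x : 0 <= x -> 0 <= dh x.
Proof.
rewrite le_eqVlt => /predU1P[<-|x0]; first by rewrite deriv_ext0.
rewrite /deriv_ext x0.
apply: (@incr_derive1_ge0_itvy _ _ true 0).
- by move=> y; rewrite inE/= in_itv/= andbT; exact: adm_derivable.
- exact: adm_increasing.
- by rewrite in_itv/= x0.
Qed.

Lemma deriv_ext_bounded (K : R) :
  exists M, forall x, 0 <= x <= K -> dh x <= M.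
Proof.
have [K0|K0] := leP 0 K; last first.
  by exists 0 => x /andP[x0 /(le_trans x0)]; rewrite leNgt K0.
have cK : {within `[0, K], continuous dh}.
  apply: continuous_subspaceW (adm_deriv_continuous h_adm) => x /=.
  by rewrite !in_itv/= andbT => /andP[].
have [m _ mM] := EVT_max K0 cK.
by exists (dh m) => x xK; apply: mM; rewrite in_itv.
Qed.

(** The point [xi] is located in two ways: the bound by the maximum controls [dh xi] through
    [deriv_sup], and the distance to [x] makes [xi] converge to [x] in difference quotients. *)
Lemma deriv_ext_mvt x y : 0 <= x -> 0 <= y ->
  exists2 xi, 0 <= xi <= Num.max x y &
    `|xi - x| <= `|y - x| /\ h y - h x = dh xi * (y - x).
Proof.
suff mvt (p q : R) : 0 <= p -> p < q ->
    exists2 xi, p < xi < q & h q - h p = dh xi * (q - p).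
  move=> x0 y0; have [xy|yx|<-] := ltgtP x y.
  - have [xi /andP[px xq] E] := mvt x y x0 xy; exists xi.
      by apply/andP; split; lra.
    by split => //; rewrite !gtr0_norm ?subr_gt0//; lra.
  - have [xi /andP[px xq] E] := mvt y x y0 yx; exists xi.
      by apply/andP; split; lra.
    split; first by rewrite !ltr0_norm ?subr_lt0//; lra.
    by rewrite -opprB E; ring.
  - exists x; first by rewrite x0 lexx.
    by rewrite !subrr mulr0.
move=> p0 pq; have [||xi xipq E] := @MVT _ h dh p q pq.
- move=> z; rewrite in_itv/= => /andP[pz _].
  have z0 : 0 < z by exact: le_lt_trans pz.
  by rewrite /deriv_ext z0 derive1E; apply: derivableP; exact: adm_derivable.
- apply: continuous_subspaceW (adm_continuous h_adm) => z /=.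
  by rewrite !in_itv/= andbT => /andP[pz _]; exact: le_trans pz.
by exists xi => //; rewrite in_itv in xipq.
Qed.

Lemma deriv_ext_cvg (x : R) (u : R^nat) : 0 <= x -> (forall n, 0 <= u n) ->
  u @ \oo --> x -> (fun n => dh (u n)) @ \oo --> dh x.
Proof.
move=> x0 u0 ux; apply/cvgrPdist_lt => e e0.
have dh_cont : {within `[0, +oo[, continuous dh} by exact: adm_deriv_continuous.
have /cvgrPdist_lt/(_ e e0) dh_near := dh_cont x.
have near_x : within `[0, +oo[ (nbhs x) [set y | `|dh x - dh y| < e].
  by rewrite nbhs_subspace_in//= in_itv/= x0.
have near_u : \forall n \near \oo, [set` `[0, +oo[] (u n) ->
  `|dh x - dh (u n)| < e by exact: ux _ near_x.
by apply: filterS near_u => n; apply; rewrite /= in_itv/= u0.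
Qed.

(** By the mean value theorem the quotient is [s * dh (xi n)] with [xi n] within [|s| / n.+1] of
    [x]. Continuity of [dh] on the closed half-line concludes, also at [x = 0]. *)
Lemma cvg_difference_quotient x s : 0 <= x ->
  (forall n, 0 <= x + n.+1%:R^-1 * s) ->
  (fun n => n.+1%:R * (h (x + n.+1%:R^-1 * s) - h x)) @ \oo --> s * dh x.
Proof.
move=> x0 xs0.
have mvt n : {xi | 0 <= xi /\ `|xi - x| <= n.+1%:R^-1 * `|s| /\
    h (x + n.+1%:R^-1 * s) - h x = dh xi * (n.+1%:R^-1 * s)}.
  apply: cid; have [xi /andP[xi0 _] [le E]] := deriv_ext_mvt x0 (xs0 n).
  move: le E; rewrite addrAC subrr add0r normrM gtr0_norm ?invr_gt0// => le E.
  by exists xi.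
pose xi n := sval (mvt n).
have xi0 n : 0 <= xi n by rewrite /xi; case: (mvt n) => ? [].
have xix n : `|xi n - x| <= n.+1%:R^-1 * `|s|.
  by rewrite /xi; case: (mvt n) => t [t0 []].
have xiE n : h (x + n.+1%:R^-1 * s) - h x = dh (xi n) * (n.+1%:R^-1 * s).
  by rewrite /xi; case: (mvt n) => t [t0 []].
have -> : (fun n => n.+1%:R * (h (x + n.+1%:R^-1 * s) - h x)) =
    (fun n => s * dh (xi n)).
  by apply/funext => n; rewrite xiE mulrCA mulVKf// mulrC.
apply: cvgM; first exact: cvg_cst.
apply: deriv_ext_cvg => //.
apply/cvgrPdistC_le => e e0; near=> n.
apply: le_trans (xix n) _.
rewrite mulrC -ler_pdivlMr ?invr_gt0// invrK mulrC -ler_pdivrMr//.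
rewrite (@le_trans _ _ n%:R) ?ler_nat//.
by near: n; exact: nbhs_infty_ger.
Unshelve. all: by end_near. Qed.

(* The [max] makes [deriv_sup] nondecreasing on the whole line, hence
   measurable. *)
Definition deriv_sup x : R :=
  sup [set dh y | y in [set y | 0 <= y <= Num.max x 0 + 1]].

Lemma deriv_sup_ge x y : 0 <= x -> 0 <= y <= x + 1 -> dh y <= deriv_sup x.
Proof.
move=> x0 yx; apply: ub_le_sup; last first.
  by exists y => //=; rewrite (max_idPl x0).
have [M dM] := deriv_ext_bounded (Num.max x 0 + 1).
by exists M => _ [z zx <-]; exact: dM.
Qed.

Lemma deriv_sup_ge0 x : 0 <= deriv_sup x.
Proof.
have [M dM] := deriv_ext_bounded (Num.max x 0 + 1).
rewrite -deriv_ext0; apply: ub_le_sup.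
  by exists M => _ [z zx <-]; exact: dM.
by exists 0 => //=; rewrite lexx addr_ge0// le_max lexx orbT.
Qed.

Lemma deriv_sup_nondecreasing : {homo deriv_sup : x y / x <= y}.
Proof.
move=> x y xy; apply: ge_sup.
  exists (dh 0), 0 => //=; by rewrite lexx addr_ge0// le_max lexx orbT.
move=> _ [z /= /andP[z0 zx] <-].
have [M dM] := deriv_ext_bounded (Num.max y 0 + 1).
apply: ub_le_sup; first by exists M => _ [t ty <-]; exact: dM.
exists z => //=; apply/andP; split => //; apply: le_trans zx _.
by rewrite lerD2r ge_max !le_max xy lexx ?orbT.
Qed.

Lemma dist_le_deriv_sup x y : 0 <= x -> 0 <= y <= x + 1 ->
  `|h y - h x| <= deriv_sup x * `|y - x|.
Proof.
move=> x0 /andP[y0 yx].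
have [xi /andP[xi0 xim] [_ ->]] := deriv_ext_mvt x0 y0.
rewrite normrM ler_wpM2r// ger0_norm ?deriv_ext_ge0// deriv_sup_ge// xi0/=.
by rewrite (le_trans xim)// ge_max yx lerDl ler01.
Qed.

Section composition.
Context {d : measure_display} {T : measurableType d}.
Variable f : T -> R.
Hypothesis mf : measurable_fun [set: T] f.
Hypothesis f0 : forall z, 0 <= f z.

Lemma measurable_comp_admissible : measurable_fun [set: T] (fun z => h (f z)).
Proof.
(* Freezing [h] at [h 0] on the negative half-line gives a function that is monotone on the whole
   line, hence measurable. *)
have -> : (fun z => h (f z)) = (fun x => h (Num.max x 0)) \o f.
  by apply/funext => z /=; rewrite (max_idPl (f0 z)).
apply: measurableT_comp mf; apply: nondecreasing_measurable => // x y xy.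
have m0 (z : R) : Num.max z 0 \in `[0, +oo[.
  by rewrite in_itv/= andbT le_max lexx orbT.
have : Num.max x 0 <= Num.max y 0.
  by rewrite ge_max !le_max xy lexx orbT.
rewrite le_eqVlt => /predU1P[->//|xy']; apply: ltW.
exact: adm_increasing.
Qed.

Lemma measurable_comp_deriv_ext : measurable_fun [set: T] (fun z => dh (f z)).
Proof.
have md : measurable_fun (`[0, +oo[ : set (measurableTypeR R)) dh.
  by apply: subspace_continuous_measurable_fun => //; exact: adm_deriv_continuous.
apply: (measurable_comp _ _ md mf) => // _ [z _ <-] /=.
by rewrite in_itv/= f0.
Qed.

Lemma measurable_comp_inv_deriv_sup :
  measurable_fun [set: T] (fun z => (1 + deriv_sup (f z))^-1).
Proof.
pose inv x := (1 + deriv_sup x)^-1.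
apply: (measurableT_comp (f := inv)) mf.
apply: nonincreasing_measurable => // x y xy.
have [x1 y1] := (deriv_sup_ge0 x, deriv_sup_ge0 y).
by rewrite lef_pV2 ?posrE ?ltr_pwDl// lerD2l deriv_sup_nondecreasing.
Qed.

End composition.

End admissible_theory.

(** * Perturbations of the optimiser *)

Section density_probability.
Local Open Scope ereal_scope.
Context {d : measure_display} {T : measurableType d} {R : realType}.
Variables (P : probability T R) (k : T -> R).
Hypothesis mk : measurable_fun [set: T] k.
Hypothesis k0 : forall z, (0 <= k z)%R.
Hypothesis k1 : \int[P]_z (k z)%:E = 1.

(** The proofs are arguments so that the measure and probability structures can be attached to the
    resulting set function. *)
Definition density_probability of measurable_fun [set: T] k &
    (forall z, (0 <= k z)%R) & \int[P]_z (k z)%:E = 1 :=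
  fun A : set T => \int[P]_(z in A) (k z)%:E.

Local Notation Q := (density_probability mk k0 k1).

Let Q0 : Q set0 = 0. Proof. exact: integral_set0. Qed.

Let Q_ge0 A : 0 <= Q A.
Proof. by apply: integral_ge0 => z _; rewrite lee_fin. Qed.

Let Q_sigma_additive : semi_sigma_additive Q.
Proof.
apply: semi_sigma_additive_nng_induced; first exact/measurable_EFinP.
by move=> z; rewrite lee_fin.
Qed.

HB.instance Definition _ := isMeasure.Build _ _ _ Q Q0 Q_ge0 Q_sigma_additive.

Let Q_setT : Q [set: T] = 1. Proof. exact: k1. Qed.

HB.instance Definition _ := @Measure_isProbability.Build _ _ R Q Q_setT.

Lemma density_probability_dominated : Q `<< P.
Proof.
apply/null_content_dominatesP => A mA A0; apply: null_set_integral => //.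
by apply: measurable_funTS; exact/measurable_EFinP.
Qed.

End density_probability.

Section density_theory.
Local Open Scope ereal_scope.
Context {R : realType} {X Y : ptopologicalType}.
Variables P Q : probability (borel X * borel Y)%type R.
Hypothesis QP : Q `<< P.

Lemma density_ge0 z : (0 <= density Q P z)%R.
Proof. by rewrite fine_ge0// Radon_Nikodym_SigmaFinite.f_ge0. Qed.

Lemma EFin_density z :
  (density Q P z)%:E = Radon_Nikodym_SigmaFinite.f Q P z.
Proof. by rewrite fineK// Radon_Nikodym_SigmaFinite.f_fin_num. Qed.

Lemma integrable_density : P.-integrable [set: borel X * borel Y]
  (fun z => (density Q P z)%:E).
Proof.
under eq_fun do rewrite EFin_density.
exact: Radon_Nikodym_SigmaFinite.f_integrable.
Qed.

Lemma measurable_density :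
  measurable_fun [set: borel X * borel Y] (density Q P).
Proof. by apply/measurable_EFinP; exact: measurable_int integrable_density. Qed.

Lemma integral_density (A : set (borel X * borel Y)) : measurable A ->
  \int[P]_(z in A) (density Q P z)%:E = Q A.
Proof.
move=> mA; under eq_integral do rewrite EFin_density.
by rewrite -Radon_Nikodym_SigmaFinite.f_integral.
Qed.

Lemma ae_density_unique (k : borel X * borel Y -> R) :
  measurable_fun [set: borel X * borel Y] k ->
  (forall A, measurable A -> \int[P]_(z in A) (k z)%:E = Q A) ->
  {ae P, forall z, density Q P z = k z}.
Proof.
move=> mk kQ.
have := @integral_ae_eq _ _ _ P setT measurableT (EFin \o k)
  (fun z => (density Q P z)%:E) integrable_density.
case; first exact/measurable_EFinP.
  by move=> A _ mA; rewrite integral_density// kQ.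
by move=> N [mN N0 sub]; exists N; split => // z nz; apply: sub => /= /(_ I) [].
Qed.

End density_theory.

(** * First-order optimality of the coupling *)

Section optimality.
Local Open Scope ereal_scope.
Context {R : realType} {X Y : ptopologicalType}.
Variables (mu : probability (borel X) R) (nu : probability (borel Y) R).
Variable P : probability (borel X * borel Y)%type R.
Variable h : R -> R.
Hypothesis h_adm : admissible h.
Hypothesis value_fin : transport_value h P mu nu \is a fin_num.
Variable Qstar : probability (borel X * borel Y)%type R.
Hypothesis Qstar_cpl : cpl mu nu Qstar.
Hypothesis Qstar_opt : objective h P Qstar = transport_value h P mu nu.

Local Notation f := (density Qstar P).
Local Notation dh := (deriv_ext h).

Lemma optimizer_dominated : Qstar `<< P.
Proof.
have := value_fin; rewrite -Qstar_opt /objective.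
by case: asboolP.
Qed.

Let f0 z : (0 <= f z)%R.
Proof. exact: density_ge0 optimizer_dominated z. Qed.

Let mf : measurable_fun [set: borel X * borel Y] f.
Proof. exact: measurable_density optimizer_dominated. Qed.

Let mhf : measurable_fun [set: borel X * borel Y] (fun z => h (f z)).
Proof. exact: measurable_comp_admissible. Qed.

Lemma objective_optimizer : objective h P Qstar = \int[P]_z (h (f z))%:E.
Proof. by rewrite /objective asboolT//; exact: optimizer_dominated. Qed.

Lemma integrable_optimizer :
  P.-integrable [set: borel X * borel Y] (fun z => (h (f z))%:E).
Proof.
apply/integrableP; split; first exact/measurable_EFinP.
by rewrite integral_fin_num_abs// -objective_optimizer Qstar_opt.
Qed.

(* Moving [f] by at most [weight] keeps it nonnegative and changes [h \o f] by
   at most [1]. *)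
Definition weight z : R :=
  ((if 0 < f z then Num.min (f z) 1 else 1) / (1 + deriv_sup h (f z)))%R.

Lemma weight_itv z : (0 < weight z <= 1)%R.
Proof.
have S0 := deriv_sup_ge0 h_adm (f z).
have S1 : (0 < 1 + deriv_sup h (f z))%R by rewrite ltr_pwDl.
rewrite /weight; case: ifPn => fz.
  rewrite divr_gt0 ?lt_min ?fz//= ler_pdivrMr// mul1r.
  by rewrite ge_min; apply/orP; right; rewrite lerDl.
by rewrite divr_gt0//= ler_pdivrMr// mul1r lerDl.
Qed.

Lemma weight_deriv_sup z : (weight z * deriv_sup h (f z) <= 1)%R.
Proof.
have S0 := deriv_sup_ge0 h_adm (f z).
have S1 : (0 < 1 + deriv_sup h (f z))%R by rewrite ltr_pwDl.
rewrite /weight mulrAC ler_pdivrMr// mul1r.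
apply: (@le_trans _ _ (1 * deriv_sup h (f z)))%R.
  by rewrite ler_wpM2r//; case: ifPn => // _; rewrite ge_min lexx orbT.
by rewrite mul1r lerDr.
Qed.

Lemma weight_deriv z : (weight z * dh (f z) <= 1)%R.
Proof.
apply: le_trans (weight_deriv_sup z); rewrite ler_wpM2l//.
  by case/andP: (weight_itv z) => /ltW.
by rewrite deriv_sup_ge// f0/= lerDl.
Qed.

Lemma weight_le_density z : (0 < f z -> weight z <= f z)%R.
Proof.
move=> fz; have S0 := deriv_sup_ge0 h_adm (f z).
rewrite /weight fz ler_pdivrMr ?ltr_pwDl//.
rewrite (@le_trans _ _ (f z))%R ?ge_min ?lexx// ler_peMr//.
by rewrite lerDl.
Qed.

Lemma measurable_positive_density :
  measurable [set z : borel X * borel Y | (0 < f z)%R].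
Proof.
rewrite [X in measurable X](_ : _ = f @^-1` `]0%R, +oo[).
  by rewrite -[X in measurable X]setTI; exact: mf.
by apply/seteqP; split => z /=; rewrite in_itv/= andbT.
Qed.

Lemma measurable_weight : measurable_fun [set: borel X * borel Y] weight.
Proof.
apply: measurable_funM.
  apply: measurable_fun_ifT => //; first exact: measurable_fun_ltr.
  exact: measurable_minr.
exact: measurable_comp_inv_deriv_sup.
Qed.

Section competitor.
Variable g : borel X * borel Y -> R.
Hypothesis mg : measurable_fun [set: borel X * borel Y] g.
Hypothesis gw : forall z, (`|g z| <= weight z)%R.
Hypothesis g_ge0 : forall z, ~ (0 < f z)%R -> (0 <= g z)%R.
Hypothesis g_fst : forall A : set (borel X), measurable A ->
  \int[P]_z (g z * \1_A z.1)%:E = 0.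
Hypothesis g_snd : forall B : set (borel Y), measurable B ->
  \int[P]_z (g z * \1_B z.2)%:E = 0.

Let w01 := weight_itv.

Let ig : P.-integrable [set: borel X * borel Y] (EFin \o g).
Proof.
apply: (@bounded_integrable _ _ _ _ _ 1%R) => // z.
by rewrite (le_trans (gw z))//; case/andP: (w01 z).
Qed.

Let itg (t : R) : P.-integrable [set: borel X * borel Y] (fun z => (t * g z)%:E).
Proof. exact: (integrableZl measurableT t ig). Qed.

Let int_indic (A : set (borel X * borel Y)) (k : borel X * borel Y -> R) :
  measurable A -> \int[P]_(z in A) (k z)%:E = \int[P]_z (k z * \1_A z)%:E.
Proof.
move=> mA; rewrite integral_mkcond; apply: eq_integral => z _.
by rewrite patchE indicE; case: ifPn => _; rewrite ?mulr1 ?mulr0.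
Qed.

Let perturb (t : R) z := (f z + t * g z)%R.

Let mperturb t : measurable_fun [set: borel X * borel Y] (perturb t).
Proof. by apply: measurable_funD => //; exact: measurable_funM. Qed.

Let perturb_integral t (A : set (borel X * borel Y)) : measurable A ->
  \int[P]_z (g z * \1_A z)%:E = 0 ->
  \int[P]_(z in A) (perturb t z)%:E = Qstar A.
Proof.
move=> mA gA0; rewrite -(integral_density optimizer_dominated mA).
under eq_integral do rewrite EFinD.
rewrite (@integralD _ _ _ P A mA (fun z => (f z)%:E)
  (fun z => (t * g z)%:E)); last 2 first.
- by apply: integrableS (integrable_density optimizer_dominated).
- by apply: integrableS (itg t).
rewrite [X in _ + X](_ : _ = 0) ?adde0//.
under eq_integral do rewrite EFinM.
rewrite integralZl//; last by apply: integrableS ig.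
by rewrite int_indic// gA0 mule0.
Qed.

(** Where [f > 0], the decrease is at most [weight z <= f z]; elsewhere [g] is nonnegative. *)
Let perturb_ge0 t z : (0 <= t <= 1 -> 0 <= perturb t z)%R.
Proof.
move=> /andP[t0 t1]; rewrite /perturb.
have [fz|fz] := boolP (0 < f z)%R; last first.
  by rewrite addr_ge0// mulr_ge0//; apply: g_ge0; exact/negP.
have /ler_normlP[gz _] := gw z.
have := weight_le_density fz; have /andP[w0 _] := w01 z.
have : (t * - g z <= weight z)%R.
  apply: (@le_trans _ _ (t * weight z))%R; first by rewrite ler_wpM2l.
  by rewrite ler_piMl// ltW.
lra.
Qed.

(** The move has size at most [t * weight z] and ends in [[0, f z + 1]], the range on which
    [deriv_sup] bounds the slope of [h]. The weight compensates that slope. *)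
Let perturb_dist t z : (0 <= t <= 1 -> `|h (perturb t z) - h (f z)| <= t)%R.
Proof.
move=> t01; have /andP[t0 t1] := t01.
have /andP[w0 w1] := w01 z.
have tg : (`|t * g z| <= t * weight z)%R by rewrite normrM ger0_norm// ler_wpM2l.
have pf : (0 <= perturb t z <= f z + 1)%R.
  rewrite perturb_ge0//= lerD2l (le_trans (ler_norm _))// (le_trans tg)//.
  by rewrite mulr_ile1// ltW.
apply: le_trans (dist_le_deriv_sup h_adm (f0 z) pf) _.
rewrite /perturb addrAC subrr add0r mulrC.
apply: (@le_trans _ _ (t * weight z * deriv_sup h (f z)))%R.
  by rewrite ler_wpM2r// deriv_sup_ge0.
by rewrite -mulrA ler_piMr// weight_deriv_sup.
Qed.

(** As [g] has null marginals, the measure with density [perturb t] is again a coupling of [mu] and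
    [nu], so it competes with the optimiser. *)
Let le_perturb t : (0 <= t <= 1)%R ->
  \int[P]_z (h (f z))%:E <= \int[P]_z (h (perturb t z))%:E.
Proof.
move=> t01.
have g1 : \int[P]_z (g z * \1_setT z)%:E = 0.
  rewrite -(g_fst measurableT); apply: eq_integral => z _.
  by rewrite !indicE !mem_set.
have k1 : \int[P]_z (perturb t z)%:E = 1.
  by rewrite perturb_integral// probability_setT.
pose Qt : probability (borel X * borel Y)%type R :=
  density_probability (mperturb t) (fun z => perturb_ge0 z t01) k1.
have QtP : Qt `<< P by exact: density_probability_dominated.
have Qt_cpl : cpl mu nu Qt.
  have [cpl1 cpl2] := Qstar_cpl; split=> [A mA|B mB].
    rewrite -cpl1//; apply: perturb_integral.
      by rewrite -[X in measurable X]setTI; exact: measurable_fst.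
    by rewrite -(g_fst mA); apply: eq_integral => z _; rewrite !indicE.
  rewrite -cpl2//; apply: perturb_integral.
    by rewrite -[X in measurable X]setTI; exact: measurable_snd.
  by rewrite -(g_snd mB); apply: eq_integral => z _; rewrite !indicE.
rewrite -objective_optimizer Qstar_opt.
(* The density of [Qt] chosen by Radon-Nikodym agrees with [perturb t] only almost everywhere. *)
have -> : \int[P]_z (h (perturb t z))%:E = objective h P Qt.
  rewrite /objective asboolT//; apply: ae_eq_integral => //.
  - apply/measurable_EFinP; apply: measurable_comp_admissible => // z.
    exact: perturb_ge0.
  - apply/measurable_EFinP; apply: measurable_comp_admissible => //.
      exact: measurable_density.
    exact: density_ge0.
  - have := ae_density_unique QtP (mperturb t) (fun A _ => erefl).
    by apply: (@filterS _ _ (ae_filter_ringOfSetsType P)) => z -> _.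
by apply: ereal_inf_lbound; exists Qt.
Qed.

(** The integral is the one-sided derivative of the objective along [perturb] at [t = 0]. The
    difference quotients are bounded by 1 thanks to [perturb_dist], so dominated convergence
    applies. *)
Lemma optimizer_first_order : 0 <= \int[P]_z (g z * dh (f z))%:E.
Proof.
pose t n : R := (n.+1%:R^-1)%R.
have t01 n : (0 <= t n <= 1)%R by rewrite invr_ge0 ler0n invf_le1// ler1n.
pose q n z := (n.+1%:R * (h (perturb (t n) z) - h (f z)))%R.
have mhp n : measurable_fun [set: borel X * borel Y] (fun z => h (perturb (t n) z)).
  by apply: measurable_comp_admissible => // z; exact: perturb_ge0.
have mq n : measurable_fun [set: borel X * borel Y] (q n).
  by apply: measurable_funM => //; exact: measurable_funB.
have q1 n z : (`|q n z| <= 1)%R.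
  rewrite normrM ger0_norm// -ler_pdivlMl// mulr1.
  exact: perturb_dist.
have q_ge0 n : 0 <= \int[P]_z (q n z)%:E.
  pose D z := (h (perturb (t n) z) - h (f z))%R.
  have mD : measurable_fun [set: borel X * borel Y] D by exact: measurable_funB.
  have iD : P.-integrable [set: borel X * borel Y] (EFin \o D).
    apply: (@bounded_integrable _ _ _ _ _ (t n)) => // z.
    exact: perturb_dist.
  under eq_integral do rewrite EFinM.
  rewrite (integralZl measurableT iD) mule_ge0 ?lee_fin//.
  have := le_perturb (t01 n).
  have -> : \int[P]_z (h (perturb (t n) z))%:E =
      \int[P]_z (h (f z))%:E + \int[P]_z (D z)%:E.
    rewrite -(integralD measurableT integrable_optimizer iD).
    by apply: eq_integral => z _; rewrite -EFinD /D addrC subrK.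
  have fh := integrable_fin_num measurableT integrable_optimizer.
  have fD := integrable_fin_num measurableT iD.
  by rewrite -(fineK fh) -(fineK fD) -EFinD !lee_fin lerDl.
have mdh := measurable_comp_deriv_ext h_adm mf f0.
have ione : P.-integrable [set: borel X * borel Y] (fun=> 1%:E).
  exact: (@bounded_integrable _ _ _ _ (fun=> 1%R) `|1|%R).
have [||||_ _ cv] := @dominated_convergence _ _ _ P _ measurableT
    (fun n z => (q n z)%:E) (fun z => (g z * dh (f z))%:E) (fun=> 1%:E)
    _ _ _ ione.
- by move=> n; exact/measurable_EFinP.
- by apply/measurable_EFinP; exact: measurable_funM.
- apply: aeW => z _; apply: cvg_EFin; first exact: nearW.
  apply: cvg_difference_quotient => // n.
  exact: (perturb_ge0 z (t01 n)).
- by apply: aeW => z n _; rewrite lee_fin.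
rewrite -(cvg_lim _ cv)//; apply: lime_ge; first by apply/cvg_ex; eexists; exact: cv.
exact: nearW.
Qed.

End competitor.

End optimality.

(** * Potentials read off from a minimiser with zero misfit *)

Local Open Scope ereal_scope.

Theorem theorem1p5 (R : realType) (X Y : ptopologicalType)
    (polishX : polish R X) (polishY : polish R Y)
    (mu : probability (borel X) R) (nu : probability (borel Y) R)
    (P : probability (borel X * borel Y)%type R)
    (P_ll : P `<< mu \x nu) (ll_P : mu \x nu `<< P)
    (h : R -> R) (h_adm : admissible h)
    (value_fin : transport_value h P mu nu \is a fin_num)
    (Qstar : probability (borel X * borel Y)%type R)
    (Qstar_cpl : cpl mu nu Qstar)
    (Qstar_opt : objective h P Qstar = transport_value h P mu nu) :
  exists (phi : borel X -> \bar R) (psi : borel Y -> \bar R),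
    [/\ measurable_fun [set: borel X] phi,
        measurable_fun [set: borel Y] psi,
        (forall x, phi x < +oo),
        (forall y, psi y < +oo) &
        {ae P, forall z, (deriv_ext h (density Qstar P z))%:E =
                         maxe (phi z.1 + psi z.2) 0}].
Proof.
have QP := optimizer_dominated value_fin Qstar_opt.
have mf := measurable_density QP; have f0 := density_ge0 QP.
pose f := density Qstar P; pose c z := deriv_ext h (f z).
pose G := [set z : borel X * borel Y | (0 < f z)%R].
have mG : measurable G by exact: (measurable_positive_density value_fin Qstar_opt).
have mc : measurable_fun [set: borel X * borel Y] c.
  exact: measurable_comp_deriv_ext.
have c0 z : (0 <= c z)%R by exact: deriv_ext_ge0.
pose w := weight P h Qstar.
have mw : measurable_fun [set: borel X * borel Y] w.
  exact: (measurable_weight h_adm value_fin Qstar_opt).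
have w01 z : (0 < w z <= 1)%R by exact: weight_itv.
have wc1 z : (w z * c z <= 1)%R by exact: (weight_deriv h_adm value_fin Qstar_opt).
have QG : Qstar (~` G) = 0.
  rewrite -(integral_density QP); last exact: measurableC.
  rewrite integral0_eq// => z /negP; rewrite -leNgt => fz; congr (_%:E).
  by apply/eqP; rewrite eq_le fz f0.
(* If [G] were [P]-null it would be [Qstar]-null, whereas [Qstar] has mass 1 and charges only
   [G]. *)
have G_neq0 : ~ {ae P, forall z, ~ G z}.
  move=> [N [mN N0 GN]]; have := oner_neq0 R; apply/negP/negPn/eqP.
  have /null_content_dominatesP/(_ N mN N0) QN := QP.
  apply: EFin_inj; rewrite -[LHS](probability_setT Qstar) -(setvU G).
  apply/eqP; rewrite -measure_le0 -[X in _ <= X]adde0 -{1}QG -QN.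
  apply: le_trans (measureU2 _ _ _) _ => //; first exact: measurableC.
  rewrite leeD2l// le_measure ?inE// => z Gz.
  by apply: GN => /=; exact.
have Q_ll : Qstar `<< mu \x nu by exact: null_dominates_trans QP P_ll.
have [cpl1 cpl2] := Qstar_cpl.
have Gx := ae_xsection_neq0 Q_ll mG QG cpl1.
have Gy := ae_ysection_neq0 Q_ll mG QG cpl2.
have [phi [psi [mphi mpsi minimal]]] :=
  exists_minimizer P_ll ll_P mG mc mw c0 w01 wc1 G_neq0 Gx Gy.
have ma := measurable_misfit mG mc mphi mpsi.
pose g z := (w z * dloss (misfit G c phi psi z))%R.
(* The derivative [g] of the energy is used as a direction of perturbation of the density. Off [G]
   the misfit is a positive part, which makes [g] nonnegative there. *)
have g_opt : 0 <= \int[P]_z (g z * c z)%:E.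
  apply: (optimizer_first_order h_adm value_fin Qstar_cpl Qstar_opt).
  - by apply: measurable_funM => //; exact: measurableT_comp measurable_dloss ma.
  - move=> z; have /andP[wz0 _] := w01 z.
    by rewrite normrM gtr0_norm// ler_piMr ?norm_dloss_le1// ltW.
  - move=> z nGz; have /andP[wz0 _] := w01 z.
    rewrite mulr_ge0 ?(ltW wz0)// dloss_ge0// /misfit memNset//=.
    by rewrite le_max lexx orbT.
  - move=> A mA.
    have := @first_order_marginals _ _ _ _ _ P G c w mG mc mw c0 w01 wc1
      phi psi mphi mpsi minimal (\1_A) (fun=> 0%R).
    under eq_integral do rewrite addr0.
    apply => // z; rewrite addr0 indicE; by case: (_ \in _); rewrite ?normr1 ?normr0.
  - move=> B mB.
    have := @first_order_marginals _ _ _ _ _ P G c w mG mc mw c0 w01 wc1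
      phi psi mphi mpsi minimal (fun=> 0%R) (\1_B).
    under eq_integral do rewrite add0r.
    apply => // z; rewrite add0r indicE; by case: (_ \in _); rewrite ?normr1 ?normr0.
have a0 := minimizer_misfit0 mG mc mw c0 w01 wc1 mphi mpsi minimal g_opt.
exists (EFin \o phi), (EFin \o psi); split.
- exact/measurable_EFinP.
- exact/measurable_EFinP.
- by move=> x; exact: ltry.
- by move=> y; exact: ltry.
apply: (@filterS _ _ (ae_filter_ringOfSetsType P)) a0 => z.
rewrite /misfit /= -EFinD -EFin_max -/(f z) -/(c z) => a0.
(* On [G] zero misfit means [phi + psi = c], which is nonnegative. Off [G] the density vanishes, so
   [c = 0], and zero misfit is exactly the vanishing of the positive part of [phi + psi]. *)
congr (_%:E); move: a0; have [Gz|nGz] := pselect (G z).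
  rewrite mem_set//= => /eqP; rewrite subr_eq0 => /eqP ->.
  by rewrite (max_idPl _).
have -> : c z = 0%R.
  have : (f z <= 0)%R by rewrite leNgt; apply/negP.
  move=> fz; rewrite /c (_ : f z = 0%R) ?deriv_ext0//.
  by apply/eqP; rewrite eq_le fz f0.
by rewrite memNset//= subr0.
Qed.
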